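(* Let $n\ge1$ and let $U$ be a depth-$d$ $\mathrm{QAC}^0$ circuit with $n$ input qubits and $a$ ancilla qubits initialized in the state $\psi$. For $k\le n$, let $\mathcal E_{U,\psi}(\rho)=\mathrm{Tr}_{[k]^c}\big[U(\rho\otimes\psi)U^\dagger\big]$ be the channel from $n$ to $k$ qubits that keeps the first $k$ output qubits, and let $\Phi_{U,\psi}=(\mathcal E_{U,\psi}\otimes\mathrm{id})(\mathrm{EPR}_n)$ be its Choi representation. Then for $\ell=\tilde O\big((n+a)^{1-3^{-d}}k^{3^{-d}/2}\big)$ and $\varepsilon=O(d/n)$, $$\deg_\varepsilon\big(2^{-k}\Phi_{U,\psi}\big)\le\ell.$$
   Context: A depth-$d$ $\mathrm{QAC}^0$ circuit on $m$ qubits is a unitary $U=L_dM_d\cdots L_1M_1L_0$ where each $L_i$ is a tensor product of single-qubit unitaries and each $M_i$ is a tensor product of multi-qubit CZ gates $I-2|1^s\rangle\langle1^s|$ on pairwise disjoint sets of qubits. $\mathrm{EPR}_n=\sum_{x,y\in\{0,1\}^n}|x\rangle\langle y|\otimes|x\rangle\langle y|$ (the unnormalized projector onto $\sum_x|x\rangle|x\rangle$); $\mathrm{Tr}_{[k]^c}$ traces out all qubits except the first $k$. Pauli degree: with $P_\sigma=\bigotimes_iP_{\sigma_i}$, $P_0=I,P_1=X,P_2=Y,P_3=Z$, write $A=\sum_\sigma\hat A(\sigma)P_\sigma$; $\deg(A)=\max\{|\{i:\sigma_i\ne0\}|:\hat A(\sigma)\neq0\}$; $\deg_\varepsilon(A)=\min\{\deg(B):\|A-B\|\le\varepsilon\}$,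 spectral norm. $O$ hides absolute constants and $\tilde O$ also polylogarithmic factors.
   Formalization: The depth is assumed to satisfy d ≥ 1: at d = 0 the error is ε = 0, and the identity circuit with k = n and a = 0 has a normalized Choi operator of exact degree 2n, exceeding the claimed Õ(√n). *)

(* Defs.v *)
From HB Require Import structures.
From mathcomp Require Import all_boot all_order all_algebra.
From mathcomp Require Import complex.
From mathcomp Require Import reals exp.

Set Implicit Arguments.
Unset Strict Implicit.
Unset Printing Implicit Defensive.

Import Order.TTheory GRing.Theory Num.Theory.
Local Open Scope ring_scope.

(* Computational basis of m qubits: bit strings x : 'I_m -> bool.      *)
Definition bits (m : nat) := {ffun 'I_m -> bool}.

Definition bitat m (x : bits m) (j : nat) : bool :=
  if insub j is Some i then x i else false.

Definition fstbits p q (x : bits (p + q)) : bits p := [ffun i : 'I_p => bitat x i].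
Definition sndbits p q (x : bits (p + q)) : bits q := [ffun j : 'I_q => bitat x (p + j)].

Definition glue m k (x : bits k) (z : bits (m - k)) : bits m :=
  [ffun i : 'I_m => if (i < k)%N then bitat x i else bitat z (i - k)].

Section Ops.
Variable R : realType.
Local Notation C := R[i].

(* Operators on m qubits, as matrices indexed by computational basis states:
   A x y = <x| A |y>. *)
Definition op (m : nat) := bits m -> bits m -> C.

Definition mulop m (A B : op m) : op m := fun x y => \sum_(z : bits m) A x z * B z y.
Definition adjop m (A : op m) : op m := fun x y => Num.conj (A y x).
Definition subop m (A B : op m) : op m := fun x y => A x y - B x y.
Definition scaleop m (c : C) (A : op m) : op m := fun x y => c * A x y.
Definition ketbra m (x y : bits m) : op m := fun u v => ((u == x) && (v == y))%:R.

Definition tensop n a (rho : op n) (psi : op a) : op (n + a) :=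
  fun x y => rho (fstbits x) (fstbits y) * psi (sndbits x) (sndbits y).

Definition ptrace m k (A : op m) : op k :=
  fun x y => \sum_(z : bits (m - k)) A (@glue m k x z) (@glue m k y z).

Definition bit2ord (b : bool) : 'I_2 := if b then ord_max else ord0.

Definition unitary2 (u : 'M[C]_2) : Prop :=
  u *m (map_mx Num.conj u)^T = 1%:M.

Definition local_layer m (L : 'I_m -> 'M[C]_2) : op m :=
  fun x y => \prod_(q : 'I_m) L q (bit2ord (x q)) (bit2ord (y q)).

(* tensor product of multi-qubit CZ gates I - 2|1^s><1^s| on the sets in S *)
Definition cz_layer m (S : seq {set 'I_m}) : op m :=
  fun x y => (x == y)%:R *
    \prod_(s <- S) (if s \subset [set q | x q] then -1 else 1).

Definition valid_cz m (S : seq {set 'I_m}) : Prop :=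
  all (fun s => s != set0) S /\ pairwise (fun s t : {set 'I_m} => [disjoint s & t]) S.

Fixpoint circ m (Ls : nat -> 'I_m -> 'M[C]_2) (Ms : nat -> seq {set 'I_m})
  (j : nat) : op m :=
  match j with
  | O => local_layer (Ls O)
  | S j' => mulop (local_layer (Ls j)) (mulop (cz_layer (Ms j)) (circ Ls Ms j'))
  end.

Definition QAC0 (d m : nat) (U : op m) : Prop :=
  exists (Ls : nat -> 'I_m -> 'M[C]_2) (Ms : nat -> seq {set 'I_m}),
    (forall i, (i <= d)%N -> forall q, unitary2 (Ls i q)) /\
    (forall i, (1 <= i <= d)%N -> valid_cz (Ms i)) /\
    U = circ Ls Ms d.

Definition is_state m (psi : op m) : Prop :=
  (forall x y, psi y x = Num.conj (psi x y)) /\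
  (forall v : bits m -> C,
      0 <= \sum_(x : bits m) \sum_(y : bits m) Num.conj (v x) * psi x y * v y) /\
  \sum_(x : bits m) psi x x = 1.

Definition chan n a k (U : op (n + a)) (psi : op a) (rho : op n) : op k :=
  @ptrace (n + a) k (mulop U (mulop (tensop rho psi) (adjop U))).

(* Choi representation (E (x) id)(EPR_n) = sum_{x,y} E(|x><y|) (x) |x><y|;
   the output of E occupies the first k qubits, the reference system the last n. *)
Definition choi n k (E : op n -> op k) : op (k + n) :=
  fun x y => E (ketbra (sndbits x) (sndbits y)) (fstbits x) (fstbits y).

Definition pauli1 (s : 'I_4) (b c : bool) : C :=
  match val s with
  | 0 => (b == c)%:R
  | 1 => (b != c)%:R
  | 2 => if b == c then 0 else if b then 'i%C else - 'i%C
  | _ => if b == c then (if b then -1 else 1) else 0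
  end.

Definition pauli m (sigma : {ffun 'I_m -> 'I_4}) : op m :=
  fun x y => \prod_(q : 'I_m) pauli1 (sigma q) (x q) (y q).

(* Pauli coefficient \hat A(sigma) = 2^{-m} Tr(P_sigma^dagger A), the unique
   coefficients with A = sum_sigma \hat A(sigma) P_sigma *)
Definition pcoef m (A : op m) (sigma : {ffun 'I_m -> 'I_4}) : C :=
  (2%:R ^+ m)^-1 *
  \sum_(x : bits m) \sum_(y : bits m) Num.conj (pauli sigma x y) * A x y.

Definition pweight m (sigma : {ffun 'I_m -> 'I_4}) : nat :=
  #|[set q | sigma q != ord0]|.

(* deg(A) = max { |supp sigma| : \hat A(sigma) != 0 } (0 for A = 0) *)
Definition pdeg m (A : op m) : nat :=
  \max_(sigma : {ffun 'I_m -> 'I_4} | pcoef A sigma != 0) pweight sigma.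

Definition opnorm_le m (A : op m) (e : R) : Prop :=
  0 <= e /\
  forall v : bits m -> C,
    \sum_(x : bits m) `|\sum_(y : bits m) A x y * v y| ^+ 2
      <= (e ^+ 2)%:C%C * \sum_(x : bits m) `|v x| ^+ 2.

(* deg_e(A) <= l : since deg_e(A) = min { deg B : ||A - B|| <= e } is a
   minimum of natural numbers, deg_e(A) <= l iff some B with ||A - B|| <= e
   has deg(B) <= l. *)
Definition degeps_le m (A : op m) (e l : R) : Prop :=
  exists B : op m, (pdeg B)%:R <= l /\ opnorm_le (subop A B) e.

End Ops.

(* Main.v *)
Require Import Defs.
From HB Require Import structures.
From mathcomp Require Import all_boot all_order all_algebra.
From mathcomp Require Import complex.
From mathcomp Require Import zify ring lra reals exp.
From mathcomp Require Import sesquilinear spectral.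
Import Order.TTheory GRing.Theory Num.Theory.
Local Open Scope ring_scope.

(* Let N = n + a and adjoin k reference qubits to the N circuit qubits. Up to the
   contraction against the ancilla state, 2^-k Phi is U^T B conj(U), where B
   projects onto k Bell pairs between the references and the first k outputs.
   In Clifford coordinates B is an AND of 2k bits, so Chebyshev polynomials
   approximate it in degree O(r sqrt k) with error 4^-r. The layers are then
   conjugated one at a time. Single-qubit layers preserve degree; CZ gates on at
   most w^2 qubits multiply it by at most w^2; the larger gates are replaced by
   diagonal polynomials of total degree O(r N / w), which are contractions, so
   errors only add up. With w = (N / l)^(1/3) the degree bound l becomes
   O(r N^(2/3) l^(1/3)), and iterating d times from l = O(r sqrt k), with r of order
   log N, gives the exponents of the theorem. *)

Set Implicit Arguments.
Unset Strict Implicit.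
Unset Printing Implicit Defensive.

(** * Pauli degree *)

Section PauliDegree.
Variables (C : numClosedFieldType) (Q : finType).
Local Notation bQ := {ffun Q -> bool}.
Local Notation opQ := (bQ -> bQ -> C).
Implicit Types (A B : opQ) (x y u v : bQ) (S : {set Q}).

(** The weight 2^-k is what makes B a projector, so the exact operator starts with norm at most 1
    and keeps it through all layers. The induction carries a pair: this exact operator and a
    low-degree companion at distance e from it. Replacing large gates by polynomials is charged to
    the exact operator, the old error only passes through contractions, and no norm bound for the
    companion is ever needed. The obstacle is a CZ gate on many qubits: conjugating by it exactly
    may multiply the degree by its size. Its approximant instead adds degree of order r times the
    square root of its size, but doing this for many small gates would add order r N. The cutoff w
    balances the factor w^2 against the addend r N / w. The logarithms do not pile up with the
    depth: each layer takes a cube root, and the prefactor of order r^2 reproduces itself. *)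

Definition idb (b c : bool) : C := (b == c)%:R.

Definition prodop (M : Q -> bool -> bool -> C) : opQ :=
  fun x y => \prod_q M q (x q) (y q).

(* dle l is the span of the product operators acting on at most l qubits, which
   is the space of operators of Pauli degree at most l. *)
Inductive dle (l : nat) : opQ -> Prop :=
| dle_prod S M of (#|S| <= l)%N & (forall q, q \notin S -> M q =2 idb) :
    dle l (prodop M)
| dle_add A B of dle l A & dle l B : dle l (fun x y => A x y + B x y)
| dle_scale c A of dle l A : dle l (fun x y => c * A x y)
| dle_ext A B of dle l A & A =2 B : dle l B.

Lemma dle_sum l (I : Type) (r : seq I) (P : pred I) (F : I -> opQ) :
  (forall i, P i -> dle l (F i)) ->
  dle l (fun x y => \sum_(i <- r | P i) F i x y).
Proof.
move=> dF; elim: r => [|i r IH].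
  apply: (@dle_ext _ (fun x y => 0 * prodop (fun=> idb) x y)).
    by apply: dle_scale; apply: (@dle_prod _ set0); rewrite ?cards0.
  by move=> x y; rewrite big_nil mul0r.
case Pi: (P i); last by apply: dle_ext IH _ => x y; rewrite big_cons Pi.
by apply: dle_ext (dle_add (dF i Pi) IH) _ => x y; rewrite big_cons Pi.
Qed.

Lemma dle_leq l l' A : (l <= l')%N -> dle l A -> dle l' A.
Proof.
move=> ll'; elim=> {A} [S M Sl MI|A B _ dA _ dB|c A _ dA|A B _ dA AB].
- by apply: (@dle_prod _ S) MI; apply: leq_trans ll'.
- exact: dle_add.
- exact: dle_scale.
- exact: dle_ext dA AB.
Qed.

Lemma dle_tr l A : dle l A -> dle l (fun x y => A y x).
Proof.
elim=> {A} [S M Sl MI|A B _ dA _ dB|c A _ dA|A B _ dA AB].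
- apply: (@dle_ext _ (prodop (fun q b c => M q c b))) => //.
  by apply: (@dle_prod _ S) => // q /MI e b c; rewrite e /idb eq_sym.
- exact: (dle_add dA dB).
- exact: (dle_scale c dA).
- by apply: dle_ext dA _ => x y; apply: AB.
Qed.

Lemma prodop_neq S M x y q :
  (forall q, q \notin S -> M q =2 idb) -> q \notin S -> x q != y q ->
  prodop M x y = 0.
Proof.
move=> MI qS xy; rewrite /prodop (bigD1 q) //= MI // /idb (negbTE xy).
by rewrite mul0r.
Qed.

(** The hypotheses describe an operator on S tensored with the identity. Expanding the part on S in
    matrix units writes it as a combination of product operators. *)
Lemma dle_local S A :
  (forall x y q, q \notin S -> x q != y q -> A x y = 0) ->
  (forall x y x' y', {in S, x =1 x'} -> {in S, y =1 y'} ->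
     (forall q, q \notin S -> x q = y q) ->
     (forall q, q \notin S -> x' q = y' q) -> A x y = A x' y') ->
  dle #|S| A.
Proof.
move=> A0 Aeq.
pose E u v q (b c : bool) : C :=
  if q \in S then ((b == u q) && (c == v q))%:R else idb b c.
(* Only strings vanishing off S label matrix units, so each matrix unit on S occurs exactly once in
   the sum. *)
pose ok u := [forall q, (q \in S) || ~~ u q].
apply: (@dle_ext _ (fun x y => \sum_(u | ok u) \sum_(v | ok v)
   A u v * prodop (E u v) x y)).
  apply: dle_sum => u _; apply: dle_sum => v _; apply: dle_scale.
  by apply: (@dle_prod _ S) => // q /negbTE qS b c; rewrite /E qS.
move=> x y; have [/existsP[q /andP[qS xyq]]|] :=
    boolP [exists q, (q \notin S) && (x q != y q)].
  rewrite (A0 _ _ _ qS xyq) big1 // => u _; rewrite big1 // => v _.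
  rewrite (@prodop_neq S _ _ _ q) ?mulr0 // => q' /negbTE q'S b c.
  by rewrite /E q'S.
rewrite negb_exists => /forallP xy.
have {}xy q : q \notin S -> x q = y q.
  by move=> qS; have := xy q; rewrite qS /= negbK => /eqP.
pose cut u : bQ := [ffun q => (q \in S) && u q].
have cutok u : ok (cut u).
  by apply/forallP => q; rewrite ffunE; case: (q \in S).
have Eq u v : ok u -> ok v ->
    prodop (E u v) x y = ((u == cut x) && (v == cut y))%:R.
  move=> /forallP uok /forallP vok.
  have [/andP[/eqP-> /eqP->]|] := boolP (_ && _).
    rewrite /prodop big1 // => q _; rewrite /E !ffunE.
    by case: ifPn => qS; rewrite ?qS /= ?eqxx // /idb (xy _ qS) eqxx.
  rewrite negb_and => h.
  have [q qS h'] : exists2 q, q \in S & (u q != x q) || (v q != y q).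
    apply/exists_inP; apply: contraLR h; rewrite negb_exists_in => /forall_inP h.
    rewrite negb_or !negbK; apply/andP; split; apply/eqP/ffunP => q.
      rewrite ffunE; case: (boolP (q \in S)) (uok q) (h q) => //= _.
        by move=> _ /(_ isT); rewrite negb_or !negbK => /andP[/eqP].
      by move=> /negbTE.
    rewrite ffunE; case: (boolP (q \in S)) (vok q) (h q) => //= _.
      by move=> _ /(_ isT); rewrite negb_or !negbK => /andP[_ /eqP].
    by move=> /negbTE.
  rewrite /prodop (bigD1 q) //= /E qS (eq_sym (x q)) (eq_sym (y q)).
  by move: h'; rewrite -negb_and => /negbTE->; rewrite mul0r.
rewrite (bigD1 (cut x)) ?cutok //= (bigD1 (cut y)) ?cutok //=.
rewrite Eq // !eqxx mulr1 big1 => [|v /andP[vok /negbTE nv]]; last first.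
  by rewrite Eq // nv andbF mulr0.
rewrite addr0 big1 ?addr0 => [|u /andP[uok /negbTE nu]]; last first.
  by rewrite big1 // => v vok; rewrite Eq // nu mulr0.
apply: Aeq => // [q qS|q qS|q qS]; rewrite !ffunE ?qS //.
by rewrite (negbTE qS).
Qed.

Lemma dle_full A : dle #|Q| A.
Proof.
rewrite -cardsT; apply: dle_local => [x y q|x y x' y' xx' yy' _ _].
  by rewrite inE.
have -> : x = x' by apply/ffunP => q; apply: xx'; rewrite inE.
by have -> : y = y' by apply/ffunP => q; apply: yy'; rewrite inE.
Qed.

Lemma card_blocks t l (nb : Q -> {set Q}) S :
  (forall q, #|nb q| <= t)%N -> (#|S| <= l)%N ->
  (#|\bigcup_(q in S) nb q| <= l * t)%N.
Proof.
move=> nbt Sl; apply: leq_trans (_ : \sum_(q in S) #|nb q| <= _)%N.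
  elim/big_ind2: _ => [|m A n B h1 h2|//]; first by rewrite cards0.
  by apply: leq_trans (leq_add h1 h2); rewrite cardsU leq_subr.
apply: leq_trans (_ : \sum_(q in S) t <= _)%N; first exact: leq_sum.
by rewrite sum_nat_const leq_mul2r Sl orbT.
Qed.

(** Upper bounds on the degree of a function as a polynomial in the bits, read off from how it is
    built; no normal form of polynomials is required. *)
Inductive fdle : nat -> (bQ -> C) -> Prop :=
| fdle_const c : fdle 0 (fun=> c)
| fdle_var q : fdle 1 (fun x => (x q)%:R)
| fdle_add l f g of fdle l f & fdle l g : fdle l (fun x => f x + g x)
| fdle_mul l l' f g of fdle l f & fdle l' g : fdle (l + l') (fun x => f x * g x)
| fdle_ext l l' f g of fdle l f & (l <= l')%N & f =1 g : fdle l' g.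

Lemma fdle_sum l (I : Type) (r : seq I) (P : pred I) (F : I -> bQ -> C) :
  (forall i, P i -> fdle l (F i)) ->
  fdle l (fun x => \sum_(i <- r | P i) F i x).
Proof.
move=> dF; elim: r => [|i r IH].
  by apply: fdle_ext (fdle_const 0) _ _ => // x; rewrite big_nil.
case Pi: (P i); last by apply: fdle_ext IH _ _ => // x; rewrite big_cons Pi.
by apply: fdle_ext (fdle_add (dF i Pi) IH) _ _ => // x; rewrite big_cons Pi.
Qed.

Lemma fdle_exp l f r : fdle l f -> fdle (l * r) (fun x => f x ^+ r).
Proof.
move=> df; elim: r => [|r IH]; first by rewrite muln0; apply: fdle_const.
by rewrite mulnS; apply: fdle_ext (fdle_mul df IH) _ _ => // x; rewrite exprS.
Qed.

Lemma dle_varM l q A : dle l A -> dle (l + 1) (fun x y => (x q)%:R * A x y).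
Proof.
elim=> {A} [S M Sl MI|A B _ dA _ dB|c A _ dA|A B _ dA AB].
- pose M' p (b c : bool) := (if p == q then b%:R else 1) * M p b c.
  apply: (@dle_ext _ (prodop M')); last first.
    move=> x y; rewrite /prodop (bigD1 q) //= [in RHS](bigD1 q) //= mulrA.
    rewrite /M' eqxx; congr (_ * _); apply: eq_bigr => p /negbTE->.
    by rewrite mul1r.
  apply: (@dle_prod _ (q |: S)).
    by rewrite cardsU1 addnC leq_add // leq_b1.
  move=> p; rewrite !inE negb_or => /andP[/negbTE pq pS] b c.
  by rewrite /M' pq mul1r MI.
- by apply: dle_ext (dle_add dA dB) _ => x y; rewrite mulrDr.
- by apply: dle_ext (dle_scale c dA) _ => x y; rewrite mulrCA.
- by apply: dle_ext dA _ => x y; rewrite AB.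
Qed.

Lemma dle_fM r f l A : fdle r f -> dle l A -> dle (l + r) (fun x y => f x * A x y).
Proof.
move=> df; elim: df l A => {r f}
  [c|q|r f g _ df _ dg|r r' f g _ df _ dg|r r' f g _ df rr' fg] l A dA.
- by rewrite addn0; apply: dle_scale.
- exact: dle_varM.
- by apply: dle_ext (dle_add (df _ _ dA) (dg _ _ dA)) _ => x y; rewrite mulrDl.
- rewrite [(r + r')%N]addnC addnA.
  by apply: dle_ext (df _ _ (dg _ _ dA)) _ => x y; rewrite mulrA.
- apply: (@dle_leq (l + r)); first by rewrite leq_add2l.
  by apply: dle_ext (df _ _ dA) _ => x y; rewrite fg.
Qed.

Lemma dle_fMf r f l A : fdle r f -> dle l A ->
  dle (l + 2 * r) (fun x y => f x * A x y * f y).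
Proof.
move=> df dA; have /dle_tr := dle_fM df dA.
move=> /(dle_fM df) /dle_tr; rewrite mul2n -addnn addnA => dfA.
by apply: dle_ext dfA _ => x y; rewrite mulrC.
Qed.

Definition cz S x : C := if S \subset [set q | x q] then -1 else 1.

Lemma cz_eq S x y : {in S, x =1 y} -> cz S x = cz S y.
Proof.
move=> xy; rewrite /cz; congr (if _ then _ else _).
by apply/subsetP/subsetP => h q qS; have := h q qS; rewrite !inE xy.
Qed.

Lemma cz_sqr S x : cz S x * cz S x = 1.
Proof. by rewrite /cz; case: ifP => _; rewrite ?mulrNN mulr1. Qed.

(** The block of [q] is its light cone: [q] with every gate through it. Disjointness leaves at most
    one such gate, and taking a union over the filtered list avoids choosing it. *)
Lemma pairwise_disjoint_block (G : seq {set Q}) t :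
  (0 < t)%N -> all (fun s : {set Q} => #|s| <= t)%N G ->
  pairwise (fun s s' : {set Q} => [disjoint s & s']) G ->
  exists nb : Q -> {set Q}, [/\ forall q, q \in nb q, forall q, (#|nb q| <= t)%N
    & forall q s, s \in G -> q \in s -> s \subset nb q].
Proof.
move=> t0 Gt dG.
exists (fun q : Q => q |: \bigcup_(s <- [seq s : {set Q} <- G | q \in s]) s).
split=> [q|q|q s sG qs]; first by rewrite !inE eqxx.
- have := subseq_pairwise (filter_subseq (fun s : {set Q} => q \in s) G) dG.
  have : all (fun s : {set Q} => (#|s| <= t)%N && (q \in s))
     [seq s : {set Q} <- G | q \in s].
    apply/allP => s; rewrite mem_filter => /andP[qs sG]; rewrite qs andbT.
    exact: (allP Gt).
  case: [seq _ <- _ | _] => [|s [|s' ss]] /=; first by rewrite big_nil setU0 cards1.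
    by rewrite big_seq1 => /andP[/andP[st qs] _] _; rewrite (setUidPr _) ?sub1set.
  move=> /and3P[/andP[_ qs] /andP[_ qs'] _] /andP[/andP[/disjointFr/(_ qs)]].
  by rewrite qs'.
- apply: subset_trans (subsetUr _ _).
  have : s \in [seq s : {set Q} <- G | q \in s] by rewrite mem_filter qs.
  elim: [seq _ <- _ | _] => // s' ss IH; rewrite inE big_cons => /orP[/eqP->|/IH h].
    exact: subsetUl.
  exact: subset_trans h (subsetUr _ _).
Qed.

(** Gates that miss the support of a product operator commute with it and cancel, since a CZ gate
    squares to 1; gates that meet the support lie inside the union of its blocks. *)
Lemma dle_cz_small (G : seq {set Q}) t l A :
  (0 < t)%N -> all (fun s : {set Q} => #|s| <= t)%N G ->
  pairwise (fun s s' : {set Q} => [disjoint s & s']) G -> dle l A ->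
  dle (l * t) (fun x y => (\prod_(s <- G) cz s x) * A x y * \prod_(s <- G) cz s y).
Proof.
move=> t0 Gt dG; have [nb [nbq nbt nbG]] := pairwise_disjoint_block t0 Gt dG.
elim=> {A} [S M Sl MI|A B _ dA _ dB|c A _ dA|A B _ dA AB]; last 3 first.
- by apply: dle_ext (dle_add dA dB) _ => x y; rewrite mulrDr mulrDl.
- by apply: dle_ext (dle_scale c dA) _ => x y; rewrite [in RHS]mulrCA !mulrA.
- by apply: dle_ext dA _ => x y; rewrite AB.
set S' := \bigcup_(q in S) nb q.
have SS' q : q \notin S' -> q \notin S.
  by apply: contra => qS; apply/bigcupP; exists q.
apply: (@dle_leq #|S'|); first exact: card_blocks.
apply: dle_local => [x y q /SS' qS xy|x y x' y' xx' yy' xy xy'].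
  by rewrite (prodop_neq MI qS xy) mulr0 mul0r.
have eM : prodop M x y = prodop M x' y'.
  apply: eq_bigr => q _; have [qS'|qS'] := boolP (q \in S').
    by rewrite xx' ?yy'.
  by rewrite !MI ?SS' // /idb xy // xy' // !eqxx.
(* A nonzero entry forces [x] and [y] to agree off [S], which is what makes the gates missing [S]
   cancel. *)
rewrite -eM; have [->|M0] := eqVneq (prodop M x y) 0; first by rewrite !mulr0 !mul0r.
have off q : q \notin S -> x q = y q.
  by move=> qS; apply/eqP; apply: contraNT M0 => /(prodop_neq MI qS)->.
have off' q : q \notin S -> x' q = y' q.
  move=> qS; apply/eqP; apply: contraNT M0 => /(prodop_neq MI qS).
  by rewrite eM => ->.
rewrite mulrAC [in RHS]mulrAC -!big_split /=; congr (_ * _).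
apply: eq_big_seq => s sG; have [sS|sS] := boolP [disjoint s & S].
  rewrite (@cz_eq s x y) => [|q qs]; last by rewrite off // (disjointFr sS).
  rewrite (@cz_eq s x' y') => [|q qs]; last by rewrite off' // (disjointFr sS).
  by rewrite !cz_sqr.
have sS' : s \subset S'.
  move: sS => /pred0Pn[q /andP[/= qs qS]].
  by apply: subset_trans (bigcup_sup q qS); apply: nbG.
by congr (_ * _); apply: cz_eq => q qs; rewrite ?xx' ?yy' ?(subsetP sS').
Qed.

End PauliDegree.

(** * Operator norm *)

Section OperatorNorm.
Variables (C : numClosedFieldType) (T : finType).
Local Notation opT := (T -> T -> C).
Implicit Types (A B : opT) (u v f g : T -> C) (e : C).

Definition sqn u : C := \sum_x `|u x| ^+ 2.

Definition bil A u v : C := \sum_x \sum_y (u x)^* * A x y * v y.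

(* By AM-GM and rescaling of u and v this says that the operator norm of A is
   at most e; the form below is visibly additive and avoids square roots. *)
Definition nle A e := forall u v, 2 * `|bil A u v| <= e * (sqn u + sqn v).

Lemma sqn_ge0 u : 0 <= sqn u.
Proof. by apply: sumr_ge0 => x _; rewrite exprn_ge0. Qed.

Lemma nle_ext A B e : A =2 B -> nle A e -> nle B e.
Proof.
move=> AB nA u v; rewrite (_ : bil B u v = bil A u v) //.
by apply: eq_bigr => x _; apply: eq_bigr => y _; rewrite AB.
Qed.

Lemma nle_le A e e' : e <= e' -> nle A e -> nle A e'.
Proof.
move=> ee' nA u v; apply: le_trans (nA u v) _.
by rewrite ler_wpM2r // addr_ge0 ?sqn_ge0.
Qed.

Lemma nle_add A B e e' :
  nle A e -> nle B e' -> nle (fun x y => A x y + B x y) (e + e').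
Proof.
move=> nA nB u v.
have -> : bil (fun x y => A x y + B x y) u v = bil A u v + bil B u v.
  rewrite /bil -big_split /=; apply: eq_bigr => x _; rewrite -big_split /=.
  by apply: eq_bigr => y _; rewrite mulrDr mulrDl.
rewrite [leRHS]mulrDl; apply: le_trans (lerD (nA u v) (nB u v)).
by rewrite -mulrDr ler_wpM2l // ler_normD.
Qed.

Lemma nle_scale A e c : nle A e -> nle (fun x y => c * A x y) (`|c| * e).
Proof.
move=> nA u v.
have -> : bil (fun x y => c * A x y) u v = c * bil A u v.
  rewrite /bil mulr_sumr; apply: eq_bigr => x _; rewrite mulr_sumr.
  by apply: eq_bigr => y _; rewrite !mulrA (mulrC c).
by rewrite normrM mulrCA -mulrA ler_wpM2l.
Qed.

Lemma sqn_mul f u : (forall x, `|f x| <= 1) -> sqn (fun x => f x * u x) <= sqn u.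
Proof.
move=> f1; apply: ler_sum => x _; rewrite normrM exprMn ler_piMl ?exprn_ge0 //.
by rewrite exprn_ile1.
Qed.

(** The diagonal factors move into the test vectors, whose norms they do not increase. *)
Lemma nle_mul_contraction f g A e : 0 <= e ->
  (forall x, `|f x| <= 1) -> (forall x, `|g x| <= 1) -> nle A e ->
  nle (fun x y => f x * A x y * g y) e.
Proof.
move=> e0 f1 g1 nA u v.
have -> : bil (fun x y => f x * A x y * g y) u v =
    bil A (fun x => (f x)^* * u x) (fun x => g x * v x).
  apply: eq_bigr => x _; apply: eq_bigr => y _.
  by rewrite rmorphM /= conjCK !mulrA (mulrC (f x)).
apply: le_trans (nA _ _) _; rewrite ler_wpM2l // lerD ?sqn_mul //.
by move=> x; rewrite norm_conjC.
Qed.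

Lemma nle_mul f g A e d d' : 0 <= e -> 0 < d -> 0 < d' ->
  (forall x, `|f x| <= d) -> (forall x, `|g x| <= d') -> nle A e ->
  nle (fun x y => f x * A x y * g y) (d * d' * e).
Proof.
move=> e0 d0 d0' fd gd nA; rewrite -(gtr0_norm (mulr_gt0 d0 d0')).
have scal (h : T -> C) (c : C) : 0 < c -> (forall x, `|h x| <= c) ->
    forall x, `|c^-1 * h x| <= 1.
  move=> c0 hc x; rewrite normrM normfV (gtr0_norm c0) ler_pdivrMl ?mulr1 //.
have := nle_mul_contraction e0 (scal f d d0 fd) (scal g d' d0' gd) nA.
move=> /(nle_scale (d * d')); apply: nle_ext => x y.
by field; rewrite !gt_eqF.
Qed.

(** Telescoping: fAf - gAg = (f - g)Af + gA(f - g). *)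
Lemma nle_conj_diff f g A d : 0 < d ->
  (forall x, `|f x| <= 1) -> (forall x, `|g x| <= 1) ->
  (forall x, `|f x - g x| <= d) -> nle A 1 ->
  nle (fun x y => f x * A x y * f y - g x * A x y * g y) (d + d).
Proof.
move=> d0 f1 g1 fg nA.
have h1 := nle_mul ler01 d0 ltr01 fg f1 nA.
have h2 := nle_mul ler01 ltr01 d0 g1 fg nA.
rewrite !mulr1 mul1r in h1 h2; apply: nle_ext (nle_add h1 h2) => x y.
by rewrite !mulrBl !mulrBr addrA subrK.
Qed.

Lemma nle_diag f d : 0 <= d -> (forall x, `|f x| <= d) ->
  nle (fun x y => (x == y)%:R * f x) d.
Proof.
move=> d0 fd u v.
have -> : bil (fun x y => (x == y)%:R * f x) u v = \sum_x (u x)^* * f x * v x.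
  apply: eq_bigr => x _; rewrite (bigD1 x) //= eqxx mul1r big1 ?addr0 // => y.
  by rewrite eq_sym => /negbTE->; rewrite mul0r mulr0 mul0r.
rewrite /sqn -big_split /=.
apply: le_trans (_ : 2 * \sum_x d * (`|u x| * `|v x|) <= _).
  rewrite ler_wpM2l //; apply: le_trans (ler_norm_sum _ _ _) _.
  apply: ler_sum => x _; rewrite !normrM norm_conjC mulrAC mulrC.
  by rewrite ler_wpM2r // mulr_ge0.
rewrite -mulr_sumr mulrCA ler_wpM2l // mulr_sumr.
apply: ler_sum => x _; rewrite -subr_ge0.
rewrite (_ : _ - _ = (`|u x| - `|v x|) ^+ 2); last by ring.
by rewrite real_exprn_even_ge0 // rpredB // normr_real.
Qed.

(* W^T A conj(W), the orientation in which a circuit acts on its Choi matrix. *)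
Definition conjop (W A : opT) : opT :=
  fun x y => \sum_X \sum_Y W X x * A X Y * (W Y y)^*.

Definition isometry (W : opT) :=
  forall a b, \sum_X W X a * (W X b)^* = (a == b)%:R.

(** The form of the conjugated operator at [u], [v] is the form of [A] at conj(W)u, conj(W)v, and
    conj(W) preserves norms. *)
Lemma nle_conjop W A e : isometry W -> nle A e -> nle (conjop W A) e.
Proof.
move=> iW nA u v; pose t w X := \sum_x (W X x)^* * w x.
have sqt w : sqn (t w) = sqn w.
  transitivity (\sum_X \sum_a \sum_b (W X a)^* * w a * (W X b * (w b)^*)).
    apply: eq_bigr => X _; rewrite normCK /t rmorph_sum /= mulr_suml.
    apply: eq_bigr => a _; rewrite mulr_sumr; apply: eq_bigr => b _.
    by rewrite rmorphM /= conjCK.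
  rewrite exchange_big; apply: eq_bigr => a _.
  rewrite exchange_big /= (bigD1 a) //= [X in _ + X]big1 ?addr0 => [|b ba].
    transitivity ((\sum_X W X a * (W X a)^*) * (w a * (w a)^*)).
      by rewrite mulr_suml; apply: eq_bigr => X _; ring.
    by rewrite iW eqxx mul1r normCK.
  rewrite (_ : \sum_X _ = (\sum_X W X b * (W X a)^*) * (w a * (w b)^*)).
    by rewrite iW (negbTE ba) mul0r.
  by rewrite mulr_suml; apply: eq_bigr => X _; ring.
rewrite -(sqt u) -(sqt v) (_ : bil (conjop W A) u v = bil A (t u) (t v)) //.
have -> : bil (conjop W A) u v =
    \sum_x \sum_y \sum_X \sum_Y (u x)^* * (W X x * A X Y * (W Y y)^*) * v y.
  apply: eq_bigr => x _; apply: eq_bigr => y _; rewrite mulr_sumr mulr_suml.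
  by apply: eq_bigr => X _; rewrite mulr_sumr mulr_suml.
have -> : bil A (t u) (t v) =
    \sum_X \sum_Y \sum_x \sum_y (u x)^* * (W X x * A X Y * (W Y y)^*) * v y.
  apply: eq_bigr => X _; apply: eq_bigr => Y _.
  rewrite rmorph_sum /= !mulr_suml; apply: eq_bigr => x _.
  rewrite mulr_sumr; apply: eq_bigr => y _; rewrite rmorphM /= conjCK; ring.
under eq_bigr do rewrite exchange_big; rewrite exchange_big /=.
apply: eq_bigr => X _; under eq_bigr do rewrite exchange_big.
by rewrite exchange_big.
Qed.

Lemma nle_reindex (h : T -> T) A e : bijective h -> nle A e ->
  nle (fun x y => A (h x) (h y)) e.
Proof.
move=> bh; have [g hK gK] := bh; move=> nA u v.
have sq w : sqn w = sqn (w \o g).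
  rewrite [RHS](reindex h) /=; last exact: onW_bij.
  by apply: eq_bigr => x _; rewrite hK.
rewrite (sq u) (sq v) (_ : bil _ u v = bil A (u \o g) (v \o g)) //.
rewrite [RHS](reindex h) /=; last exact: onW_bij.
apply: eq_bigr => x _; rewrite [RHS](reindex h) /=; last exact: onW_bij.
by apply: eq_bigr => y _; rewrite !hK.
Qed.

End OperatorNorm.

(** * Polynomial approximation of AND *)

Section Chebyshev.
Variable C : numClosedFieldType.
Implicit Types (x d : C) (m : nat).

(* The pair (T_(m+1), U_m) of Chebyshev polynomials of the two kinds. *)
Fixpoint cheb x m : C * C :=
  if m is m'.+1 then
    let: (t, u) := cheb x m' in (x * t - (1 - x ^+ 2) * u, x * u + t)
  else (x, 1).

Lemma chebS x m : cheb x m.+1 =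
  (x * (cheb x m).1 - (1 - x ^+ 2) * (cheb x m).2, x * (cheb x m).2 + (cheb x m).1).
Proof. by rewrite /=; case: (cheb x m). Qed.

(** This is cos^2 + sin^2 = 1 at x = cos t. It bounds the first component on [0, 1] without
    trigonometry. *)
Lemma cheb_pell x m :
  (cheb x m).1 ^+ 2 + (1 - x ^+ 2) * (cheb x m).2 ^+ 2 = 1.
Proof.
elim: m => [|m IH]; first by rewrite /=; ring.
by rewrite chebS -[RHS]IH /=; ring.
Qed.

Lemma cheb_real x m : x \is Num.real ->
  ((cheb x m).1 \is Num.real) && ((cheb x m).2 \is Num.real).
Proof.
move=> xr; elim: m => [|m /andP[tr ur]]; first by rewrite /= xr real1.
by rewrite chebS /= !(realB, realD, realM, realX) ?real1.
Qed.

Lemma cheb_le1 x m : 0 <= x <= 1 -> (cheb x m).1 ^+ 2 <= 1.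
Proof.
move=> /andP[x0 x1]; have /andP[_ ur] := cheb_real m (ger0_real x0).
rewrite -[X in _ <= X](cheb_pell x m) lerDl mulr_ge0 //.
  by rewrite subr_ge0 exprn_ile1.
exact: real_exprn_even_ge0.
Qed.

(** The first bound is the tangent line of T_(m+1) at 1, whose slope is (m+1)^2; the second is the
    value of U_m at 1. Each bound feeds the induction step of the other. *)
Lemma cheb_growth d m : 0 <= d ->
  (1 + m.+1%:R ^+ 2 * d <= (cheb (1 + d) m).1) && (m.+1%:R <= (cheb (1 + d) m).2).
Proof.
move=> d0; elim: m => [|m /andP[ht hu]].
  by rewrite /= expr1n mul1r !lexx.
rewrite chebS /=; set t := _.1 in ht *; set u := _.2 in hu *.
have t1 : 1 <= t by apply: le_trans ht; rewrite lerDl mulr_ge0 ?exprn_ge0.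
have u0 : 0 <= u by apply: le_trans hu.
apply/andP; split.
  rewrite (_ : _ - _ = t + d * (t - 1) + d + d * (2 * u) + d ^+ 2 * u); last ring.
  rewrite -subr_ge0.
  have -> : t + d * (t - 1) + d + d * (2 * u) + d ^+ 2 * u -
     (1 + m.+2%:R ^+ 2 * d) = (t - (1 + m.+1%:R ^+ 2 * d)) + d * (t - 1) +
       d * (2 * (u - m.+1%:R)) + d ^+ 2 * u.
    rewrite -(natr1 m.+1); ring.
  apply: addr_ge0; [apply: addr_ge0; [apply: addr_ge0|]|];
    by rewrite ?mulr_ge0 ?subr_ge0 ?exprn_ge0.
rewrite -(natr1 m.+1) -subr_ge0.
rewrite (_ : _ - _ = (u - m.+1%:R) + (t - 1) + d * u); last ring.
by apply: addr_ge0; [apply: addr_ge0|]; rewrite ?mulr_ge0 ?subr_ge0.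
Qed.

Lemma fdle_cheb (Q : finType) (f : {ffun Q -> bool} -> C) m : fdle 1 f ->
  fdle m.+1 (fun y => (cheb (f y) m).1) /\ fdle m (fun y => (cheb (f y) m).2).
Proof.
move=> df; elim: m => [|m [dt du]]; first by split=> //; apply: fdle_const.
have dN l (g : {ffun Q -> bool} -> C) :
    fdle l g -> fdle l (fun y : {ffun Q -> bool} => - g y).
  by move=> dg; apply: fdle_ext (fdle_mul (fdle_const Q (-1)) dg) _ _ => // x;
    rewrite mulN1r.
have d1f : fdle 2 (fun y => 1 - f y ^+ 2).
  apply: fdle_add; first exact: fdle_ext (fdle_const Q 1) _ _.
  exact/dN/(fdle_exp 2 df).
split.
  have h1 : fdle m.+2 _ := fdle_mul df dt.
  have h2 : fdle m.+2 _ := dN _ _ (fdle_mul d1f du).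
  by apply: fdle_ext (fdle_add h1 h2) _ _ => // y; rewrite chebS.
have h : fdle m.+1 _ := fdle_mul df du.
by apply: fdle_ext (fdle_add h dt) _ _ => // y; rewrite chebS.
Qed.

End Chebyshev.

(** Here m + 1 is the square root of s rounded up, and it becomes the degree of the Chebyshev
    polynomial. *)
Lemma exists_sqrt_approx s : (0 < s)%N -> exists m, (s <= m.+1 ^ 2 <= 4 * s)%N.
Proof.
move=> s0; have ex : exists m, (s <= m.+1 ^ 2)%N by exists s; lia.
exists (ex_minn ex); case: ex_minnP => m -> mmin; rewrite andTb.
case: m mmin => [|m] mmin; first lia.
have [/mmin|] := leqP s (m.+1 ^ 2); first by rewrite ltnn.
by rewrite !expnS !expn0; nia.
Qed.

Section AndApproximation.
Variables (C : numClosedFieldType) (Q : finType).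
Local Notation bQ := {ffun Q -> bool}.
Implicit Types (s : {set Q}) (x y : bQ).

Definition allones s x := s \subset [set q | x q].

Lemma count_ones s x : \sum_(q in s) (x q)%:R = #|[set q in s | x q]|%:R :> C.
Proof.
rewrite -natr_sum -sum1dep_card; congr (_%:R).
rewrite [RHS]big_mkcondr /=; apply: eq_bigr => q _.
by case: (x q).
Qed.

(* p is an even power of T_m(z) / T_m(1 + 1/s), where z = (#ones + 1) / s lies
   in [0, 1] unless all s bits are one, and T_m(1 + 1/s) >= 1 + m^2/s >= 2. *)
Lemma and_approx s r : s != set0 ->
  exists (m : nat) (p : bQ -> C), [/\ (m ^ 2 <= 4 * #|s|)%N, fdle (m * 2 * r) p &
    forall x, if allones s x then p x = 1 else 0 <= p x <= (4 ^ r)%:R^-1].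
Proof.
rewrite -card_gt0 => s0; have [m /andP[sm ms]] := exists_sqrt_approx s0.
set c : C := #|s|%:R; have c0 : 0 < c by rewrite ltr0n.
pose z x : C := c^-1 * (\sum_(q in s) (x q)%:R + 1).
pose tau := (cheb (1 + c^-1) m).1.
have tau2 : 2 <= tau.
  have cV0 : 0 <= c^-1 by rewrite invr_ge0 ltW.
  have /andP[h _] := cheb_growth m cV0.
  apply: le_trans h; rewrite (_ : 2 = 1 + 1) // lerD2l ler_pdivlMr // mul1r.
  by rewrite -natrX ler_nat.
have tau0 : 0 < tau by apply: lt_le_trans tau2.
exists m.+1, (fun x => ((tau^-1 * (cheb (z x) m).1) ^+ 2) ^+ r); split=> //.
  have dz : fdle 1 z.
    apply: fdle_mul (fdle_const _ _) _ => //.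
    apply: fdle_add; first by apply: fdle_sum => q _; apply: fdle_var.
    exact: fdle_ext (fdle_const Q 1) _ _.
  apply: fdle_exp; apply: fdle_exp.
  exact: (fdle_mul (fdle_const Q tau^-1) (proj1 (fdle_cheb m dz))).
move=> x; case: ifPn => [/subsetP sx|nsx].
  rewrite (_ : z x = 1 + c^-1) -/tau ?mulVf ?gt_eqF ?expr1n //.
  rewrite /z count_ones (_ : [set q in s | x q] = s) -/c; last first.
    by apply/setP => q; rewrite inE andb_idr // => /sx; rewrite inE.
  by rewrite mulrDr mulVf ?gt_eqF // mulr1.
have zx : 0 <= z x <= 1.
  rewrite /z count_ones natr1 mulr_ge0 ?invr_ge0 ?(ltW c0) //=.
  rewrite ler_pdivrMl // mulr1 ler_nat; apply: proper_card.
  apply/properP; split; first by apply/subsetP => q; rewrite inE => /andP[].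
  by move: nsx => /subsetPn[q qs]; rewrite inE => nx; exists q; rewrite // inE qs.
have tr : (cheb (z x) m).1 \is Num.real.
  by case/andP: zx => z0 _; case/andP: (cheb_real m (ger0_real z0)).
have t2 : 0 <= (tau^-1 * (cheb (z x) m).1) ^+ 2 <= 4^-1.
  apply/andP; split.
    by rewrite real_exprn_even_ge0 // realM // realV gtr0_real.
  rewrite exprMn; apply: le_trans (_ : tau^-1 ^+ 2 * 1 <= _).
    by rewrite ler_wpM2l ?cheb_le1 // exprn_ge0 // invr_ge0 ltW.
  rewrite mulr1 exprVn lef_pV2 ?posrE ?exprn_gt0 //.
  rewrite (_ : 4 = 2 ^+ 2 :> C); last by rewrite -natrX.
  by rewrite lerXn2r ?nnegrE // ltW.
case/andP: t2 => t0 t4; rewrite exprn_ge0 //= natrX -exprVn lerXn2r //.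
by rewrite nnegrE invr_ge0.
Qed.

(** A CZ gate is 1 - 2 AND, so the approximant is 1 - 2p. It is a contraction because p takes values
    in [0, 1]; this is why the approximation of AND was made an even power. *)
Lemma cz_approx s r : s != set0 ->
  exists (m : nat) (g : bQ -> C), [/\ (m ^ 2 <= 4 * #|s|)%N, fdle (m * 2 * r) g,
    forall x, `|g x| <= 1 & forall x, `|cz C s x - g x| <= 2 * (4 ^ r)%:R^-1].
Proof.
move=> /(and_approx r)[m [p [ms dp pE]]].
have r1 : (4 ^ r)%:R^-1 <= 1 :> C by rewrite invf_le1 ?ler1n ?ltr0n ?expn_gt0.
have p01 x : 0 <= p x <= 1.
  move: (pE x); case: ifP => [_ ->|_ /andP[-> /le_trans->//]].
  by rewrite ler01 lexx.
exists m, (fun x => 1 + -2 * p x); split=> // [|x|x].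
- apply: fdle_add; first exact: fdle_ext (fdle_const Q 1) _ _.
  exact: (fdle_mul (fdle_const Q (-2)) dp).
- case/andP: (p01 x) => p0 p1; rewrite real_ler_norml; last first.
    by rewrite realD ?realM ?realN ?ger0_real.
  apply/andP; split; rewrite -subr_ge0.
    by rewrite (_ : _ - _ = 2 * (1 - p x)) ?mulr_ge0 ?subr_ge0 //; ring.
  by rewrite (_ : _ - _ = 2 * p x) ?mulr_ge0 //; ring.
- move: (pE x); rewrite /cz -/(allones s x); case: ifP => _ => [->|/andP[p0 p4]].
    by rewrite (_ : _ - _ = 0) ?normr0 ?mulr_ge0 ?invr_ge0 //; ring.
  rewrite (_ : _ - _ = 2 * p x); last ring.
  by rewrite ger0_norm ?mulr_ge0 // ler_wpM2l.
Qed.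

End AndApproximation.

(** * Layers of CZ gates *)

Section CZLayer.
Variables (C : numClosedFieldType) (Q : finType).
Local Notation bQ := {ffun Q -> bool}.
Local Notation opQ := (bQ -> bQ -> C).
Implicit Types (s : {set Q}) (G : seq {set Q}) (x y : bQ) (A B : opQ) (e : C).

Definition disjoint_gates G := pairwise (fun s s' : {set Q} => [disjoint s & s']) G.

Definition czs G x : C := \prod_(s <- G) cz C s x.

Definition conj_czs G A : opQ := fun x y => czs G x * A x y * czs G y.

Lemma sum_card_gates G : disjoint_gates G -> (\sum_(s <- G) #|s| <= #|Q|)%N.
Proof.
move=> dG; apply: leq_trans (max_card (mem (\bigcup_(s <- G) s))).
elim: G dG => [|s G IH]; first by rewrite !big_nil.
rewrite /disjoint_gates /= => /andP[sG /IH {}IH]; rewrite !big_cons cardsU.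
rewrite (_ : s :&: _ = set0) ?cards0 ?subn0 ?leq_add2l //.
apply/setP => q; rewrite !inE; apply/negbTE/andP => -[qs].
elim: G sG {IH} => [|s' G IH]; first by rewrite big_nil inE.
rewrite /= big_cons inE => /andP[ss' /IH {}IH] /orP[|/IH//].
by rewrite (disjointFr ss' qs).
Qed.

Lemma normr_cz s x : `|cz C s x| = 1.
Proof. by rewrite /cz; case: ifP; rewrite ?normrN normr1. Qed.

Lemma normr_czs G x : `|czs G x| = 1.
Proof. by rewrite normr_prod big1 // => s _; rewrite normr_cz. Qed.

Lemma nle_conj_czs G A e : 0 <= e -> nle A e -> nle (conj_czs G A) e.
Proof. by move=> e0; apply: nle_mul_contraction => // x; rewrite normr_czs. Qed.

(** A gate on s qubits costs degree at most 4 r sqrt(s), and sqrt(s) <= s / w once s > w^2. The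
    degree bound is multiplied through by [w] to stay in the natural numbers. *)
Lemma czs_large_approx G w r :
  all (fun s => s != set0) G -> all (fun s : {set Q} => w ^ 2 < #|s|)%N G ->
  exists D g, [/\ fdle D g, (D * w <= 4 * r * \sum_(s <- G) #|s|)%N,
    forall x, `|g x| <= 1 &
    forall x, `|czs G x - g x| <= (size G)%:R * (2 * (4 ^ r)%:R^-1)].
Proof.
elim: G => [|s G IH] /=.
  move=> _ _; exists 0, (fun=> 1); split=> [|//|x|x]; first exact: fdle_const.
    by rewrite normr1.
  by rewrite /czs big_nil subrr normr0 mul0r.
move=> /andP[s0 /IH{}IH] /andP[ws /IH [D [g [dg Dw g1 gG]]]].
have [m [h [ms dh h1 hs]]] := cz_approx C r s0.
exists (m * 2 * r + D)%N, (fun x => h x * g x); split=> [||x|x].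
- exact: fdle_mul.
- rewrite big_cons mulnDl mulnDr leq_add //.
  rewrite (_ : _ * w = 2 * r * (m * w))%N; last ring.
  rewrite (_ : 4 * r * _ = 2 * r * (2 * #|s|))%N; last ring.
  rewrite leq_mul2l; apply/orP; right; rewrite -leq_sqr !expnMn.
  by move: ms ws; rewrite !expnS !expn0 !muln1; nia.
- by rewrite normrM mulr_ile1.
- rewrite /czs big_cons -/(czs G x).
  (* Telescoping over the gates: since all factors have modulus at most 1, the errors of the gates
     add. *)
  rewrite (_ : _ - _ = (cz C s x - h x) * g x + cz C s x * (czs G x - g x)); last ring.
  rewrite -natr1 [leRHS]mulrDl mul1r [leRHS]addrC; apply: le_trans (ler_normD _ _) _.
  rewrite !normrM normr_cz mul1r lerD //; apply: le_trans (hs x).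
  by rewrite ler_piMr.
Qed.

(** Diagonal gates commute, so the layer splits into small gates, conjugated exactly, and large
    gates, replaced by [g]. There are at most [#|Q|] large gates, each with error 2 / 4^r, and [g]
    stands on both sides: hence the constant 4. The old error [e] is only multiplied by
    contractions. *)
Lemma conj_czs_approx G w r l A B e :
  (0 < w)%N -> (0 < #|Q|)%N -> 0 <= e ->
  all (fun s => s != set0) G -> disjoint_gates G ->
  nle A 1 -> dle l B -> nle (fun x y => A x y - B x y) e ->
  exists D B', [/\ (D * w <= 4 * r * #|Q|)%N, dle (l * w ^ 2 + 2 * D) B' &
    nle (fun x y => conj_czs G A x y - B' x y) (4 * #|Q|%:R * (4 ^ r)%:R^-1 + e)].
Proof.
move=> w0 Q0 e0 G0 dG nA dB nAB.
pose big s := (w ^ 2 < #|s|)%N.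
pose Gl := [seq s <- G | big s]; pose Gs := [seq s <- G | ~~ big s].
have czG x : czs G x = czs Gl x * czs Gs x.
  by rewrite /czs !big_filter (bigID big).
have sub (a : pred {set Q}) P : all P G -> all P (filter a G).
  by move=> PG; apply/allP => s; rewrite mem_filter => /andP[_ /(allP PG)].
have dsub a : disjoint_gates (filter a G).
  exact: subseq_pairwise (filter_subseq _ _) dG.
have Gl2 : all (fun s : {set Q} => w ^ 2 < #|s|)%N Gl by apply: filter_all.
have [D [g [dg Dw g1 gG]]] := czs_large_approx r (sub big _ G0) Gl2.
have sumQ := sum_card_gates (dsub big).
have sizeQ : (size Gl <= #|Q|)%N.
  apply: leq_trans sumQ; rewrite -sum1_size big_seq [X in (_ <= X)%N]big_seq.
  apply: leq_sum => s; rewrite card_gt0; exact: (allP (sub big _ G0)).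
have Gs2 : all (fun s : {set Q} => #|s| <= w ^ 2)%N Gs.
  by apply: sub_all (filter_all _ _) => s; rewrite /big -leqNgt.
have w20 : (0 < w ^ 2)%N by rewrite expn_gt0 w0.
have dS := dle_cz_small w20 Gs2 (dsub _) dB.
exists D, (fun x y => g x * conj_czs Gs B x y * g y); split.
- by apply: leq_trans Dw _; rewrite leq_mul2l sumQ orbT.
- exact: dle_fMf dg dS.
have d0 : 0 < #|Q|%:R * (2 * (4 ^ r)%:R^-1) :> C.
  by rewrite !mulr_gt0 ?invr_gt0 ?ltr0n ?expn_gt0.
have gd x : `|czs Gl x - g x| <= #|Q|%:R * (2 * (4 ^ r)%:R^-1).
  apply: le_trans (gG x) _; rewrite ler_wpM2r ?ler_nat //.
  by rewrite mulr_ge0 ?invr_ge0.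
have cz1 x : `|czs Gl x| <= 1 by rewrite normr_czs.
have h1 := nle_conj_diff d0 cz1 g1 gd (nle_conj_czs Gs ler01 nA).
have h2 := nle_mul_contraction e0 g1 g1 (nle_conj_czs Gs e0 nAB).
apply: nle_le (nle_ext _ (nle_add h1 h2)).
  by rewrite lerD2r le_eqVlt; apply/orP; left; apply/eqP; ring.
move=> x y; rewrite /conj_czs !czG; ring.
Qed.

(** Every gate counts as small for the cutoff [#|Q|]. The use is at degree 0, where the factor does
    no harm. *)
Lemma conj_czs_exact G l A : (0 < #|Q|)%N -> disjoint_gates G ->
  dle l A -> dle (l * #|Q|) (conj_czs G A).
Proof. by move=> Q0 dG; apply: dle_cz_small => //; apply/allP => s _; apply: max_card. Qed.

End CZLayer.

(** * Conjugation by product operators *)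

Section ConjugationByProducts.
Variables (C : numClosedFieldType) (Q : finType).
Local Notation bQ := {ffun Q -> bool}.
Local Notation opQ := (bQ -> bQ -> C).

Lemma conjop_ext (T : finType) (V W A B : T -> T -> C) :
  V =2 W -> A =2 B -> conjop V A =2 conjop W B.
Proof.
move=> VW AB x y; apply: eq_bigr => X _; apply: eq_bigr => Y _.
by rewrite !VW AB.
Qed.

Lemma conjop_mul (T : finType) (V W A : T -> T -> C) :
  conjop (fun X x => \sum_Z V X Z * W Z x) A =2 conjop W (conjop V A).
Proof.
move=> x y.
transitivity (\sum_X \sum_Y \sum_Z \sum_Z'
   (W Z x * (V X Z * A X Y * (V Y Z')^*) * (W Z' y)^*)).
  apply: eq_bigr => X _; apply: eq_bigr => Y _.
  rewrite !mulr_suml; apply: eq_bigr => Z _.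
  rewrite rmorph_sum /= mulr_sumr; apply: eq_bigr => Z' _.
  by rewrite rmorphM /=; ring.
transitivity (\sum_Z \sum_Z' \sum_X \sum_Y
   (W Z x * (V X Z * A X Y * (V Y Z')^*) * (W Z' y)^*)).
  under eq_bigr do rewrite exchange_big; rewrite exchange_big /=.
  apply: eq_bigr => Z _; under eq_bigr do rewrite exchange_big.
  by rewrite exchange_big.
apply: eq_bigr => Z _; apply: eq_bigr => Z' _.
rewrite /conjop mulr_sumr mulr_suml; apply: eq_bigr => X _.
by rewrite mulr_sumr mulr_suml.
Qed.

Lemma conjop_sub (T : finType) (W A B : T -> T -> C) :
  conjop W (fun x y => A x y - B x y) =2 (fun x y => conjop W A x y - conjop W B x y).
Proof.
move=> x y; rewrite /conjop -sumrB; apply: eq_bigr => X _; rewrite -sumrB.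
by apply: eq_bigr => Y _; rewrite mulrBr mulrBl.
Qed.

Lemma sum_prod_ffun (F : Q -> bool -> C) :
  \sum_(X : bQ) \prod_q F q (X q) = \prod_q \sum_b F q b.
Proof. by rewrite bigA_distr_bigA. Qed.

Definition unitary_factor (m : bool -> bool -> C) :=
  forall c c', \sum_b m b c * (m b c')^* = (c == c')%:R.

Lemma prod_eqbit (x y : bQ) : \prod_q (x q == y q)%:R = (x == y)%:R :> C.
Proof.
have [->|/eqP xy] := eqVneq x y; first by rewrite big1 // => q _; rewrite eqxx.
have [q xyq] : exists q, x q != y q.
  by apply/existsP; rewrite -negb_forall; apply/negP => /forallP h; apply: xy;
    apply/ffunP => q; apply/eqP.
by rewrite (bigD1 q) //= (negbTE xyq) mul0r.
Qed.

Lemma isometry_prodop (M : Q -> bool -> bool -> C) :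
  (forall q, unitary_factor (M q)) -> isometry (prodop M).
Proof.
move=> uM a b; rewrite -prod_eqbit.
rewrite -(eq_bigr _ (fun q _ => uM q (a q) (b q))) -sum_prod_ffun.
by apply: eq_bigr => X _; rewrite rmorph_prod -big_split.
Qed.

Lemma conjop_prodop (M N : Q -> bool -> bool -> C) :
  conjop (prodop M) (prodop N) =2
  prodop (fun q => fun c c' => \sum_b \sum_b' M q b c * N q b b' * (M q b' c')^*).
Proof.
move=> x y; rewrite /prodop -sum_prod_ffun; apply: eq_bigr => X _.
rewrite -sum_prod_ffun; apply: eq_bigr => Y _.
by rewrite rmorph_prod -!big_split.
Qed.

Lemma dle_conj_prodop (M : Q -> bool -> bool -> C) l (A : opQ) :
  (forall q, unitary_factor (M q)) -> dle l A -> dle l (conjop (prodop M) A).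
Proof.
move=> uM; elim=> {A} [S N Sl NI|A B _ dA _ dB|c A _ dA|A B _ dA AB].
- apply: dle_ext (fun x y => esym (conjop_prodop M N x y)).
  apply: dle_prod Sl _ => q /NI Nq c c'; rewrite -[RHS](uM q).
  apply: eq_bigr => b _; rewrite (bigD1 b) //= big1 ?addr0 => [|b' /negbTE bb'].
    by rewrite Nq /idb eqxx mulr1.
  by rewrite Nq /idb eq_sym bb' mulr0 mul0r.
- apply: dle_ext (dle_add dA dB) _ => x y; rewrite /conjop -big_split /=.
  apply: eq_bigr => X _; rewrite -big_split /=; apply: eq_bigr => Y _.
  by rewrite mulrDr mulrDl.
- apply: dle_ext (dle_scale c dA) _ => x y; rewrite /conjop mulr_sumr.
  apply: eq_bigr => X _; rewrite mulr_sumr; apply: eq_bigr => Y _.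
  by ring.
- by apply: dle_ext dA _ => x y; apply: conjop_ext.
Qed.

End ConjugationByProducts.

(** * Reference qubits side by side with circuit qubits *)

Section Joint.
Variables (C : numClosedFieldType) (K N : finType).
Local Notation bK := {ffun K -> bool}.
Local Notation bN := {ffun N -> bool}.
Local Notation bQ := {ffun (K + N)%type -> bool}.

Definition pr1 (x : bQ) : bK := [ffun i => x (inl i)].
Definition pr2 (x : bQ) : bN := [ffun j => x (inr j)].
Definition jn (a : bK) (b : bN) : bQ :=
  [ffun q => match q with inl i => a i | inr j => b j end].

Lemma pr1_jn a b : pr1 (jn a b) = a.
Proof. by apply/ffunP => i; rewrite !ffunE. Qed.
Lemma pr2_jn a b : pr2 (jn a b) = b.
Proof. by apply/ffunP => i; rewrite !ffunE. Qed.
Lemma jn_pr x : jn (pr1 x) (pr2 x) = x.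
Proof. by apply/ffunP => -[i|j]; rewrite !ffunE. Qed.

Lemma sum_jn (F : bQ -> C) : \sum_x F x = \sum_a \sum_b F (jn a b).
Proof.
rewrite pair_big /= (reindex (fun p : bK * bN => jn p.1 p.2)) //=.
apply: onW_bij; exists (fun x => (pr1 x, pr2 x)) => [[a b]|x] /=.
  by rewrite pr1_jn pr2_jn.
exact: jn_pr.
Qed.

Lemma sum_diracl (T : finType) (a : T) (F : T -> C) :
  \sum_x (a == x)%:R * F x = F a.
Proof.
rewrite (bigD1 a) //= eqxx mul1r big1 ?addr0 // => x.
by rewrite eq_sym => /negbTE->; rewrite mul0r.
Qed.

Definition liftop (U : bN -> bN -> C) (X x : bQ) : C :=
  (pr1 X == pr1 x)%:R * U (pr2 X) (pr2 x).

Lemma liftop_mul (V W : bN -> bN -> C) :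
  liftop (fun X x => \sum_Z V X Z * W Z x) =2
  (fun X x => \sum_Z liftop V X Z * liftop W Z x).
Proof.
move=> X x; rewrite sum_jn /liftop.
transitivity (\sum_a (pr1 X == a)%:R *
    ((a == pr1 x)%:R * \sum_Z V (pr2 X) Z * W Z (pr2 x))).
  by rewrite sum_diracl.
apply: eq_bigr => a _; rewrite 2!mulr_sumr; apply: eq_bigr => b _.
rewrite !pr1_jn !pr2_jn; ring.
Qed.

Lemma conjop_liftop (U : bN -> bN -> C) (A : bQ -> bQ -> C) x y :
  conjop (liftop U) A x y =
  \sum_X \sum_Y U X (pr2 x) * A (jn (pr1 x) X) (jn (pr1 y) Y) * (U Y (pr2 y))^*.
Proof.
rewrite /conjop sum_jn.
transitivity (\sum_a (pr1 x == a)%:R * \sum_X \sum_b (pr1 y == b)%:R *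
   \sum_Y U X (pr2 x) * A (jn a X) (jn b Y) * (U Y (pr2 y))^*).
  apply: eq_bigr => a _; rewrite mulr_sumr; apply: eq_bigr => X _.
  rewrite sum_jn mulr_sumr; apply: eq_bigr => b _; rewrite 2!mulr_sumr.
  apply: eq_bigr => Y _; rewrite /liftop !pr1_jn !pr2_jn rmorphM /= conjC_nat.
  by rewrite (eq_sym a) (eq_sym b) /=; ring.
by rewrite sum_diracl; apply: eq_bigr => X _; rewrite sum_diracl.
Qed.

Definition lift_factor (L : N -> bool -> bool -> C) (q : K + N) : bool -> bool -> C :=
  match q with inl _ => @idb C | inr j => L j end.

Lemma liftop_prodop (L : N -> bool -> bool -> C) :
  liftop (prodop L) =2 prodop (lift_factor L).
Proof.
move=> X x; rewrite /prodop big_sumType /= -/(prodop L _ _) /liftop -prod_eqbit.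
congr (_ * _); first by apply: eq_bigr => i _; rewrite !ffunE.
by apply: eq_bigr => j _; rewrite !ffunE.
Qed.

Lemma unitary_lift_factor L : (forall j, unitary_factor (L j)) ->
  forall q, unitary_factor (lift_factor L q).
Proof.
move=> uL [i|j] //= c c'.
by rewrite big_bool /idb; case: c c' => [] [] /=;
  rewrite ?(mulr0, mul0r, mulr1, add0r, addr0, conjC0, conjC1).
Qed.

Lemma cz_inr (s : {set N}) x : cz C (inr @: s : {set K + N}) x = cz C s (pr2 x).
Proof.
rewrite /cz; congr (if _ then _ else _).
apply/subsetP/subsetP => h q.
  by move=> qs; have := h _ (imset_f inr qs); rewrite !inE ffunE.
by case/imsetP => j js ->; have := h _ js; rewrite !inE ffunE.
Qed.

Lemma conjop_lift_cz (G : seq {set N}) (A : bQ -> bQ -> C) :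
  conjop (liftop (fun x y => (x == y)%:R * czs C G x)) A =2
  conj_czs [seq inr @: s : {set K + N} | s : {set N} <- G] A.
Proof.
move=> x y; have czG z : czs C [seq inr @: s : {set K + N} | s : {set N} <- G] z
    = czs C G (pr2 z).
  by rewrite /czs big_map; apply: eq_bigr => s _; rewrite cz_inr.
rewrite conjop_liftop /conj_czs !czG.
transitivity (\sum_X (pr2 x == X)%:R * \sum_Y (pr2 y == Y)%:R *
  (czs C G X * A (jn (pr1 x) X) (jn (pr1 y) Y) * czs C G Y)).
  apply: eq_bigr => X _; rewrite mulr_sumr; apply: eq_bigr => Y _.
  rewrite rmorphM /= conjC_nat (eq_sym X) (eq_sym Y).
  have -> : (czs C G Y)^* = czs C G Y.
    rewrite rmorph_prod; apply: eq_bigr => s _ /=; rewrite /cz; case: ifP => _.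
      by rewrite rmorphN /= conjC1.
    exact: conjC1.
  by ring.
by rewrite !sum_diracl !jn_pr.
Qed.

Lemma disjoint_lift (G : seq {set N}) : disjoint_gates G ->
  disjoint_gates [seq inr @: s : {set K + N} | s : {set N} <- G].
Proof.
rewrite /disjoint_gates pairwise_map; apply: sub_pairwise => s s' ss' /=.
rewrite -setI_eq0 -imsetI; last by move=> ? ? _ _ [].
by move: ss'; rewrite -setI_eq0 => /eqP->; rewrite imset0.
Qed.

Lemma nonempty_lift (G : seq {set N}) : all (fun s => s != set0) G ->
  all (fun s => s != set0) [seq inr @: s : {set K + N} | s : {set N} <- G].
Proof. by rewrite all_map; apply: sub_all => s /=; rewrite imset_eq0. Qed.

End Joint.

(** * Bell pairs *)

(** The basis permutation [h] mixes a bit only with its partner under [tau], and so does its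
    inverse, which is [h] itself. A support S can therefore grow only to its union with its image
    under [tau]. *)
Lemma dle_pairing (C : numClosedFieldType) (Q : finType) (tau : Q -> Q)
    (h : {ffun Q -> bool} -> {ffun Q -> bool}) l
    (A : {ffun Q -> bool} -> {ffun Q -> bool} -> C) :
  involutive tau -> involutive h ->
  (forall (x x' : {ffun Q -> bool}) q,
     x q = x' q -> x (tau q) = x' (tau q) -> h x q = h x' q) ->
  dle l A -> dle (l * 2) (fun x y => A (h x) (h y)).
Proof.
move=> tauK hK hloc; elim=> {A} [S M Sl MI|A B _ dA _ dB|c A _ dA|A B _ dA AB];
  last 3 first.
- exact: (dle_add dA dB).
- exact: (dle_scale c dA).
- by apply: dle_ext dA _ => x y; apply: AB.
set S' := S :|: tau @: S.
have S'E q : (q \in S') = (q \in S) || (tau q \in S).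
  by rewrite inE -[in q \in tau @: S](tauK q) mem_imset //; exact: inv_inj.
have S'tau q : (tau q \in S') = (q \in S') by rewrite !S'E tauK orbC.
apply: (@dle_leq _ _ #|S'|).
  rewrite muln2 -addnn; apply: leq_trans (leq_card_setU _ _) _.
  by rewrite leq_add // (leq_trans (leq_imset_card _ _)).
apply: dle_local => [x y q qS' xy|x y x' y' xx' yy' xy xy'].
  apply/eqP; apply: contraNT xy => A0.
  have off p : p \notin S -> h x p = h y p.
    by move=> pS; apply/eqP; apply: contraNT A0 => /(prodop_neq MI pS)->.
  move: qS'; rewrite S'E negb_or => /andP[qS tqS].
  by rewrite -(hK x) -(hK y); apply/eqP/hloc; apply: off.
apply: eq_bigr => q _; have [qS'|qS'] := boolP (q \in S').
  by rewrite (hloc x x') ?(hloc y y') ?xx' ?yy' ?S'tau.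
have /MI Mq : q \notin S by move: qS'; rewrite S'E negb_or => /andP[].
rewrite !Mq /idb (hloc x y) ?xy ?S'tau // (hloc x' y') ?xy' ?S'tau //.
by rewrite !eqxx.
Qed.

Section BellProjector.
Variables (C : numClosedFieldType) (k m : nat).
Hypothesis km : (k <= m)%N.
Local Notation Q := ('I_k + 'I_m)%type.
Local Notation bQ := {ffun Q -> bool}.

Definition partner (q : Q) : Q :=
  match q with
  | inl i => inr (widen_ord km i)
  | inr j => if insub (val j) is Some i then inl i else inr j
  end.

Lemma partnerK : involutive partner.
Proof.
case=> [i|j] /=; first by rewrite valK.
case: insubP => [i ik ij|nk] /=; last by rewrite insubN.
by congr inr; apply: val_inj.
Qed.

(** A CNOT from each kept output onto its reference, followed by X: the reference bit becomes 1
    exactly when the two bits agree, so that agreement turns into an all-ones test. *)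
Definition flip_refs (x : bQ) : bQ :=
  [ffun q => match q with
             | inl i => x (inl i) == x (partner (inl i))
             | inr j => x (inr j)
             end].

Lemma flip_refsK : involutive flip_refs.
Proof.
move=> x; apply/ffunP => -[i|j]; rewrite !ffunE //=.
by case: (x (inl i)); case: (x _).
Qed.

Lemma flip_refs_local (x x' : bQ) q :
  x q = x' q -> x (partner q) = x' (partner q) -> flip_refs x q = flip_refs x' q.
Proof. by case: q => [i|j]; rewrite !ffunE => -> // ->. Qed.

(** The Hadamard matrix with its rows exchanged: the row of [true] is the uniform one, so
    conjugation sends the projector onto 1, not 0, to the projector onto the state |+>. *)
Definition hada (b c : bool) : C := sqrtC 2^-1 * (if ~~ b && c then -1 else 1).

Lemma sqrtC_half_sqr : sqrtC 2^-1 * sqrtC 2^-1 = 2^-1 :> C.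
Proof. by rewrite -expr2 sqrtCK. Qed.

Lemma conj_hada b c : (hada b c)^* = hada b c.
Proof.
rewrite /hada rmorphM /= geC0_conj ?sqrtC_ge0 ?invr_ge0 //; congr (_ * _).
by case: ifP => _; rewrite ?rmorphN /= conjC1.
Qed.

Lemma unitary_hada : unitary_factor hada.
Proof.
move=> c c'; rewrite big_bool !conj_hada /hada /=.
set s := sqrtC _; set f := if c then _ else _; set f' := if c' then _ else _.
rewrite (_ : _ + _ = (s * s) * (1 + f * f')); last ring.
rewrite sqrtC_half_sqr /f /f'.
by case: c c' {f f'} => [] [] /=; field.
Qed.

Definition bell_factor (q : Q) : bool -> bool -> C :=
  match q with
  | inl _ => @idb C
  | inr j => if (j < k)%N then hada else @idb C
  end.

Lemma unitary_bell_factor q : unitary_factor (bell_factor q).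
Proof.
have uid : unitary_factor (@idb C).
  move=> c c'; rewrite big_bool /idb; case: c c' => [] [] /=;
    by rewrite ?(mulr0, mul0r, mulr1, add0r, addr0, conjC0, conjC1).
by case: q => [i|j] //=; case: ifP => _ //; exact: unitary_hada.
Qed.

Definition bell_set : {set Q} :=
  [set q : Q | if q is inr j then (j < k)%N else true].

Lemma card_bell_set : #|bell_set| = (2 * k)%N.
Proof.
rewrite -sum1_card big_mkcond big_sumType /=.
rewrite (eq_bigr (fun=> 1%N)) => [|i _]; last by rewrite inE.
rewrite sum1_card card_ord mul2n -addnn; congr (_ + _)%N.
rewrite (eq_bigr (fun j : 'I_m => (j < k : nat)%N)) => [|j _]; last first.
  by rewrite inE; case: ltnP.
rewrite -(big_mkord xpredT (fun j => (j < k : nat)%N)) (big_cat_nat (n := k)) //=.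
rewrite [X in (_ + X)%N]big_nat_cond [X in (_ + X)%N]big1 ?addn0; last first.
  by move=> j /andP[/andP[kj _] _]; rewrite ltnNge kj.
rewrite big_nat_cond (eq_bigr (fun=> 1%N)) => [|j /andP[/andP[_ ->]]//].
by rewrite -big_nat_cond sum_nat_const_nat subn0 muln1.
Qed.

Definition and_proj (x y : bQ) : C := (x == y)%:R * (allones bell_set x)%:R.

(* Conjugating the projector onto |1...1> by Hadamards and reading the result in
   permuted coordinates gives the projector onto k Bell pairs (Lemma bellE). *)
Definition bell (x y : bQ) : C :=
  conjop (prodop bell_factor) and_proj (flip_refs x) (flip_refs y).

Lemma and_projE :
  and_proj =2 prodop (fun q b c => if q \in bell_set then (b && c)%:R else idb C b c).
Proof.
move=> x y; rewrite /and_proj -prod_eqbit.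
have -> : (allones bell_set x)%:R = \prod_q (if q \in bell_set then (x q)%:R else 1) :> C.
  case: (boolP (allones _ x)) => [/subsetP sx|/subsetPn[q qs]].
    by rewrite big1 // => q _; case: ifP => // /sx; rewrite inE => ->.
  by rewrite inE => /negbTE nx; rewrite (bigD1 q) //= qs nx mul0r.
rewrite -big_split; apply: eq_bigr => q _ /=; case: ifP => _; rewrite ?mulr1 //.
by case: (x q); case: (y q); rewrite /= ?mulr0 ?mulr1.
Qed.

Lemma bellE (x y : bQ) : bell x y =
  (\prod_i ((x (inl i) == x (partner (inl i))) && (y (inl i) == y (partner (inl i))))%:R) *
  \prod_(j < m) (if (j < k)%N then 2^-1 else (x (inr j) == y (inr j))%:R).
Proof.
rewrite /bell (conjop_ext (fun _ _ => erefl) and_projE) conjop_prodop.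
rewrite /prodop big_sumType /=; congr (_ * _); apply: eq_bigr => q _.
  rewrite !big_bool /= !inE !ffunE /= /idb; move: (x (inl q) == _) (y (inl q) == _) => b c.
  by case: b c => [] [] /=;
    rewrite ?(mulr0, mul0r, mulr1, add0r, addr0, conjC0, conjC1).
rewrite !big_bool !inE !ffunE /=; case: ifP => qk.
  by rewrite conj_hada !(mulr0, mul0r, addr0) /hada /= !mulr1 sqrtC_half_sqr.
by rewrite /idb; case: (x _); case: (y _);
  rewrite /= ?(mulr0, mul0r, mulr1, add0r, addr0, conjC0, conjC1).
Qed.

(** The AND has 2k bits, hence 8k = 4 * 2k. Its degree [w * 2 * r] is unchanged by the Hadamards and
    doubled by [flip_refs]; both keep the norm of the diagonal error. *)
Lemma bell_approx r : (0 < k)%N -> nle bell 1 /\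
  exists (w : nat) (B : bQ -> bQ -> C), [/\ (w ^ 2 <= 8 * k)%N, dle (4 * w * r) B &
    nle (fun x y => bell x y - B x y) (4 ^ r)%:R^-1].
Proof.
move=> k0; have s0 : bell_set != set0.
  by rewrite -card_gt0 card_bell_set muln_gt0.
have bij_flip : bijective flip_refs by exists flip_refs; exact: flip_refsK.
have iso := isometry_prodop unitary_bell_factor.
split.
  apply: (nle_reindex bij_flip); apply: (nle_conjop iso).
  by apply: nle_diag => // x; case: allones; rewrite ?normr1 ?normr0.
have [w [p [ws dp pE]]] := and_approx C r s0.
pose P (x y : bQ) : C := (x == y)%:R * p x.
exists w, (fun x y => conjop (prodop bell_factor) P (flip_refs x) (flip_refs y)).
split; first by move: ws; rewrite card_bell_set mulnA.
- apply: (@dle_leq _ _ ((0 + w * 2 * r) * 2)); first lia.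
  apply: (dle_pairing partnerK flip_refsK flip_refs_local).
  apply: (dle_conj_prodop unitary_bell_factor).
  apply: dle_ext (dle_fM dp (_ : dle 0 (prodop (fun=> @idb C)))) _.
    by apply: (@dle_prod _ _ _ set0); rewrite ?cards0.
  by move=> x y; rewrite /P -prod_eqbit mulrC.
- have := @nle_reindex _ _ _ _ ((4 ^ r)%:R^-1) bij_flip (nle_conjop iso _).
  move=> /(_ (fun x y => (x == y)%:R * ((allones bell_set x)%:R - p x))) h.
  apply: nle_ext (h _) => [x y|].
    rewrite /bell -conjop_sub; apply: conjop_ext => // X Y.
    by rewrite /and_proj /P mulrBr.
  apply: nle_diag => [|x]; first by rewrite invr_ge0.
  move: (pE x); case: allones => [->|/andP[p0 p4]].
    by rewrite subrr normr0 invr_ge0.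
  by rewrite sub0r normrN ger0_norm.
Qed.

End BellProjector.

(** * Circuits *)

Section Circuits.
Variables (R : realType) (K : finType) (m : nat).
Local Notation C := R[i].
Local Notation Q := (K + 'I_m)%type.
Local Notation opQ := ({ffun Q -> bool} -> {ffun Q -> bool} -> C).
Implicit Types (Ls : nat -> 'I_m -> 'M[C]_2) (Ms : nat -> seq {set 'I_m}).
Implicit Types (A B : opQ).

Definition bit_factor (u : 'M[C]_2) (b c : bool) : C := u (bit2ord b) (bit2ord c).

Lemma unitary_bit_factor u : unitary2 u -> unitary_factor (bit_factor u).
Proof.
(* [unitary2] states that the rows are orthonormal, whereas [unitary_factor] asks it of the
   columns. *)
move=> /mulmx1C/matrixP uu c c'.
have := uu (bit2ord c') (bit2ord c); rewrite !mxE big_ord_recl big_ord1.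
rewrite !mxE (_ : lift ord0 ord0 = bit2ord true); last exact: val_inj.
rewrite (_ : ord0 = bit2ord false); last exact: val_inj.
rewrite (_ : (_ == _ :> 'I_2) = (c == c')); last by case: c c' => [] [].
by rewrite big_bool /bit_factor => <-; rewrite addrC ![(_)^* * _]mulrC.
Qed.

Definition lifted_local (L : 'I_m -> 'M[C]_2) : Q -> bool -> bool -> C :=
  @lift_factor C K 'I_m (fun q => bit_factor (L q)).

Definition lifted_gates (G : seq {set 'I_m}) : seq {set Q} :=
  [seq inr @: s : {set Q} | s : {set 'I_m} <- G].

Lemma unitary_lifted_local L :
  (forall q, unitary2 (L q)) -> forall q, unitary_factor (lifted_local L q).
Proof. by move=> uL; apply: unitary_lift_factor => q; apply: unitary_bit_factor. Qed.

Lemma valid_lifted_gates G : valid_cz G ->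
  all (fun s => s != set0) (lifted_gates G) /\ disjoint_gates (lifted_gates G).
Proof. by case=> G0 dG; split; [apply: nonempty_lift|apply: disjoint_lift]. Qed.

Lemma conjop_circ0 Ls Ms A :
  conjop (liftop (circ Ls Ms 0)) A =2 conjop (prodop (lifted_local (Ls 0%N))) A.
Proof. by apply: conjop_ext => // X x; apply: liftop_prodop. Qed.

(** Heisenberg picture: the last layer of the circuit is the first to reach the operator on the
    outputs. *)
Lemma conjop_circS Ls Ms j A :
  conjop (liftop (circ Ls Ms j.+1)) A =2
  conjop (liftop (circ Ls Ms j))
    (conj_czs (lifted_gates (Ms j.+1)) (conjop (prodop (lifted_local (Ls j.+1))) A)).
Proof.
move=> x y; rewrite (conjop_ext (@liftop_mul C K 'I_m _ _) (fun _ _ => erefl)) conjop_mul.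
rewrite (conjop_ext (@liftop_mul C K 'I_m _ _) (fun _ _ => erefl)) conjop_mul.
apply: conjop_ext => // {x y} x y; rewrite conjop_lift_cz /conj_czs.
congr (_ * _ * _); apply: conjop_ext => // X {}x; exact: liftop_prodop.
Qed.

(* good i l says that degree l is within the budget after i layers; its second
   alternative covers budgets exceeding the trivial degree bound #|Q|. *)
Lemma circ_approx (r : nat) (good : nat -> nat -> Prop) :
  (0 < #|{: Q}|)%N ->
  (forall i l, good i l ->
     (exists2 w, (0 < w)%N & forall D, (D * w <= 4 * r * #|{: Q}|)%N ->
        good i.+1 (l * w ^ 2 + 2 * D)%N) \/
     good i.+1 #|{: Q}|) ->
  forall Ls Ms j i l A B (e : C),
  (forall j', (j' <= j)%N -> forall q, unitary2 (Ls j' q)) ->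
  (forall j', (1 <= j' <= j)%N -> valid_cz (Ms j')) ->
  0 <= e -> nle A 1 -> nle (fun x y => A x y - B x y) e -> dle l B -> good i l ->
  exists l' B', [/\ good (i + j)%N l', dle l' B' &
    nle (fun x y => conjop (liftop (circ Ls Ms j)) A x y - B' x y)
      (j%:R * (4 * #|{: Q}|%:R * (4 ^ r)%:R^-1) + e)].
Proof.
move=> Q0 step Ls Ms; set eta : C := 4 * _ * _.
have eta0 : 0 <= eta by rewrite !mulr_ge0 ?invr_ge0.
elim=> [|j IH] i l A B e uL vM e0 nA nAB dB gl.
  have uL0 := unitary_lifted_local (uL 0%N isT).
  exists l, (conjop (prodop (lifted_local (Ls 0%N))) B); split.
  - by rewrite addn0.
  - exact: dle_conj_prodop.
  - rewrite mul0r add0r.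
    apply: nle_ext (nle_conjop (isometry_prodop uL0) nAB) => x y.
    by rewrite conjop_sub conjop_circ0.
have uLj := unitary_lifted_local (uL j.+1 (leqnn _)).
have [G0 dG] := valid_lifted_gates (vM j.+1 (leqnn _)).
set W := prodop (lifted_local (Ls j.+1)) in uLj *.
have iW : isometry W := isometry_prodop uLj.
have nWA := nle_conjop iW nA.
have dWB := dle_conj_prodop uLj dB.
have nWAB : nle (fun x y => conjop W A x y - conjop W B x y) e.
  by apply: nle_ext (nle_conjop iW nAB) => x y; rewrite conjop_sub.
set G := lifted_gates _ in G0 dG.
have next l1 B1 : good i.+1 l1 -> dle l1 B1 ->
    nle (fun x y => conj_czs G (conjop W A) x y - B1 x y) (eta + e) ->
    exists l' B', [/\ good (i + j.+1)%N l', dle l' B' &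
      nle (fun x y => conjop (liftop (circ Ls Ms j.+1)) A x y - B' x y)
      (j.+1%:R * eta + e)].
  move=> gl1 dB1 nB1.
  have [|||l' [B' [gl' dB' nB']]] :=
    IH i.+1 l1 _ B1 _ _ _ _ (nle_conj_czs G ler01 nWA) nB1 dB1 gl1.
  - by move=> j' jj'; apply: uL; apply: leqW.
  - by move=> j' /andP[j1 jj']; apply: vM; rewrite j1 leqW.
  - by rewrite addr_ge0.
  - exists l', B'; split=> //; first by rewrite addnS -addSn.
    rewrite -natr1 mulrDl mul1r -addrA; apply: nle_ext nB' => x y.
    by rewrite conjop_circS.
case: (step i l gl) => [[w w0 gw]|gQ].
  have [D [B1 [Dw dB1 nB1]]] := conj_czs_approx r w0 Q0 e0 G0 dG nWA dWB nWAB.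
  exact: next (gw D Dw) dB1 nB1.
(* When the budget allows full degree, the exact operator serves as its own approximant and the
   accumulated error is discarded. *)
apply: (next _ (conj_czs G (conjop W A)) gQ); first exact: dle_full.
move=> u v; rewrite /bil big1 => [|x _]; last first.
  by rewrite big1 // => y _; rewrite subrr mulr0 mul0r.
by rewrite normr0 mulr0 mulr_ge0 // addr_ge0 // sqn_ge0.
Qed.

(** Serves the case k = 0, where the claimed degree bound is 0. *)
Lemma circ_exact Ls Ms j A :
  (0 < #|{: Q}|)%N ->
  (forall j', (j' <= j)%N -> forall q, unitary2 (Ls j' q)) ->
  (forall j', (1 <= j' <= j)%N -> valid_cz (Ms j')) ->
  dle 0 A -> dle 0 (conjop (liftop (circ Ls Ms j)) A).
Proof.
move=> Q0; elim: j A => [|j IH] A uL vM dA.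
  apply: dle_ext (fun x y => esym (conjop_circ0 Ls Ms A x y)).
  exact: dle_conj_prodop (unitary_lifted_local (uL 0%N isT)) dA.
apply: dle_ext (fun x y => esym (conjop_circS Ls Ms j A x y)).
apply: IH => [j' jj'|j' /andP[j1 jj']|].
- by apply: uL; apply: leqW.
- by apply: vM; rewrite j1 leqW.
- have [_ dG] := valid_lifted_gates (vM j.+1 (leqnn _)).
  have := dle_conj_prodop (unitary_lifted_local (uL j.+1 (leqnn _))) dA.
  by move=> /(conj_czs_exact Q0 dG).
Qed.

End Circuits.

(** * From the circuit to the Choi representation *)

Section ChoiReduction.
Variable R : realType.
Local Notation C := R[i].

Lemma bitatE m (x : bits m) (i : 'I_m) : bitat x i = x i.
Proof. by rewrite /bitat valK. Qed.

Lemma fstbitsE p q (x : bits (p + q)) i : fstbits x i = x (lshift q i).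
Proof. by rewrite ffunE -[in RHS](bitatE x). Qed.

Lemma sndbitsE p q (x : bits (p + q)) j : sndbits x j = x (rshift p j).
Proof. by rewrite ffunE -[in RHS](bitatE x). Qed.

Definition catbits p q (x : bits p) (w : bits q) : bits (p + q) :=
  [ffun r => match split r with inl i => x i | inr j => w j end].

Lemma split_lshift p q (i : 'I_p) : split (lshift q i) = inl i.
Proof. exact: (unsplitK (inl i)). Qed.

Lemma split_rshift p q (j : 'I_q) : split (rshift p j) = inr j.
Proof. exact: (unsplitK (inr j)). Qed.

Lemma fst_catbits p q (x : bits p) (w : bits q) : fstbits (catbits x w) = x.
Proof. by apply/ffunP => i; rewrite fstbitsE ffunE split_lshift. Qed.

Lemma snd_catbits p q (x : bits p) (w : bits q) : sndbits (catbits x w) = w.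
Proof. by apply/ffunP => i; rewrite sndbitsE ffunE split_rshift. Qed.

Lemma catbits_fst_snd p q (x : bits (p + q)) : catbits (fstbits x) (sndbits x) = x.
Proof.
apply/ffunP => r; rewrite ffunE -[in RHS](splitK r).
by case: (split r) => i; rewrite /= ?fstbitsE ?sndbitsE.
Qed.

Lemma sum_catbits p q (F : bits (p + q) -> C) :
  \sum_x F x = \sum_x \sum_w F (catbits x w).
Proof.
rewrite pair_big /= (reindex (fun r : bits p * bits q => catbits r.1 r.2)) //=.
apply: onW_bij; exists (fun x => (fstbits x, sndbits x)) => [[x w]|x] /=.
  by rewrite fst_catbits snd_catbits.
exact: catbits_fst_snd.
Qed.

Lemma prod_bool (T : finType) (P b : pred T) :
  \prod_(i | P i) (b i)%:R = [forall i, P i ==> b i]%:R :> C.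
Proof.
have [/forallP h|] := boolP [forall i, P i ==> b i].
  by rewrite big1 // => i Pi; have := h i; rewrite Pi /= => ->.
case/forallPn => i; rewrite negb_imply => /andP[Pi /negbTE bi].
by rewrite (bigD1 i) //= bi mul0r.
Qed.

Section Reduce.
Variables (n a k : nat).
Hypothesis km : (k <= n + a)%N.
Local Notation m := (n + a)%N.
Local Notation Q := ('I_k + 'I_m)%type.
Local Notation bQ := {ffun Q -> bool}.
Local Notation opQ := (bQ -> bQ -> C).

Lemma card_ord_ltn : #|[pred j : 'I_m | (j < k)%N]| = k.
Proof.
rewrite -[RHS]card_ord -(card_image (f := widen_ord km)); last first.
  by move=> i i' /(congr1 val) /= /val_inj.
apply: eq_card => j; rewrite inE; apply/idP/imageP => [jk|[i _ ->]] /=.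
  by exists (Ordinal jk) => //; apply: val_inj.
by case: i.
Qed.

Lemma eq_glue (x1 : bits k) (X : bits m) (z : bits (m - k)) :
  (X == glue x1 z) = [forall i, x1 i == X (widen_ord km i)] &&
    ([ffun t : 'I_(m - k) => bitat X (k + t)] == z).
Proof.
apply/eqP/andP => [->|[/forallP h /eqP zE]].
  split; first by apply/forallP => i; rewrite ffunE /= ltn_ord bitatE.
  apply/eqP/ffunP => t; rewrite ffunE.
  have ktm : (k + t < m)%N by rewrite -ltn_subRL.
  rewrite (bitatE _ (Ordinal ktm)) ffunE /= ltnNge leq_addr /= addKn.
  exact: bitatE.
apply/ffunP => i; rewrite ffunE; case: ltnP => ik.
  have := h (Ordinal ik); rewrite (bitatE _ (Ordinal ik)) => /eqP->.
  by congr (X _); apply: val_inj.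
have tm : (i - k < m - k)%N by rewrite ltn_sub2r // (leq_ltn_trans ik).
by rewrite (bitatE _ (Ordinal tm)) -zE ffunE /= subnKC // bitatE.
Qed.

(** The Bell projector pins the first k bits to [x1] and [y1] and forces the remaining bits to
    agree; their common value is the index of the partial trace, and the Bell normalisation supplies
    2^-k. *)
Lemma bell_sum (x1 y1 : bits k) (g : bits m -> bits m -> C) :
  \sum_X \sum_Y g X Y * @bell C _ _ km (jn x1 X) (jn y1 Y) =
  (2%:R ^+ k)^-1 * \sum_(z : bits (m - k)) g (glue x1 z) (glue y1 z).
Proof.
have bellz X Y : @bell C _ _ km (jn x1 X) (jn y1 Y) =
    (2%:R ^+ k)^-1 * \sum_z (X == glue x1 z)%:R * (Y == glue y1 z)%:R.
  rewrite bellE prod_bool (bigID (fun j : 'I_m => (j < k)%N)) /=.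
  rewrite (eq_bigr (fun=> 2^-1)) => [|j ->//].
  rewrite prodr_const card_ord_ltn exprVn mulrCA; congr (_ * _).
  rewrite (eq_bigr (fun j => (X j == Y j)%:R)) => [|j /negbTE->]; last first.
    by rewrite !ffunE.
  rewrite prod_bool.
  pose tl (X : bits m) := [ffun t : 'I_(m - k) => bitat X (k + t)].
  transitivity (([forall i, x1 i == X (widen_ord km i)] &&
     [forall i, y1 i == Y (widen_ord km i)])%:R * (tl X == tl Y)%:R : C).
    congr (_%:R * _%:R).
      apply: congr1; apply/forallP/andP => [h|[/forallP h1 /forallP h2] i].
        by split; apply/forallP => i; have := h i; rewrite /= !ffunE => /andP[].
      by rewrite /= !ffunE h1 h2.
    apply: congr1; apply/forallP/eqP => [h|h j].
      apply/ffunP => t; rewrite !ffunE.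
      have ktm : (k + t < m)%N by rewrite -ltn_subRL.
      rewrite !(bitatE _ (Ordinal ktm)); apply/eqP; have := h (Ordinal ktm).
      by rewrite /= -leqNgt leq_addr.
    apply/implyP; rewrite -leqNgt => kj.
    have tm : (j - k < m - k)%N by rewrite ltn_sub2r // (leq_ltn_trans kj).
    have := congr1 (fun f : bits (m - k) => f (Ordinal tm)) h.
    by rewrite !ffunE /= subnKC // !bitatE => ->.
  rewrite -(sum_diracl (tl X) (fun z => (z == tl Y)%:R : C)) mulr_sumr.
  apply: eq_bigr => z _; rewrite !eq_glue -/(tl X) -/(tl Y) -!natrM !mulnb.
  by rewrite (eq_sym z) andbACA.
rewrite mulr_sumr.
transitivity (\sum_z \sum_X \sum_Y (X == glue x1 z)%:R * ((Y == glue y1 z)%:R *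
    ((2%:R ^+ k)^-1 * g X Y)) : C).
  rewrite [RHS]exchange_big; apply: eq_bigr => X _.
  rewrite [RHS]exchange_big; apply: eq_bigr => Y _; rewrite bellz mulrCA mulr_sumr mulr_sumr.
  by apply: eq_bigr => z _; ring.
apply: eq_bigr => z _; rewrite -[RHS](sum_diracl (glue x1 z) (fun X =>
   (2%:R ^+ k)^-1 * g X (glue y1 z))); apply: eq_bigr => X _.
rewrite -mulr_sumr eq_sym; congr (_ * _).
rewrite -[RHS](sum_diracl (glue y1 z) (fun Y => (2%:R ^+ k)^-1 * g X Y)).
by apply: eq_bigr => Y _; rewrite eq_sym.
Qed.

(** The partial trace over the ancillas of F times the transpose of [psi]. *)
Definition reduce (psi : op R a) (F : opQ) : op R (k + n) := fun x y =>
  \sum_w \sum_w' psi w w' * F (jn (fstbits x) (catbits (sndbits x) w))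
                             (jn (fstbits y) (catbits (sndbits y) w')).

(** The channel input, which is the reference system of the Choi matrix, labels columns of [U],
    while the outputs label rows. Hence the transposed orientation of [conjop]. *)
Lemma choi_chanE (U : op R m) (psi : op R a) x y :
  scaleop ((2%:R ^+ k)^-1) (choi (@chan R n a k U psi)) x y =
  reduce psi (conjop (liftop U) (@bell C _ _ km)) x y.
Proof.
pose g w w' X Y := psi w w' * (U X (catbits (sndbits x) w) *
   (U Y (catbits (sndbits y) w'))^*).
transitivity (\sum_w \sum_w' (2%:R ^+ k)^-1 *
   \sum_(z : bits (m - k)) g w w' (glue (fstbits x) z) (glue (fstbits y) z)).
  rewrite /scaleop /choi /chan /ptrace mulr_sumr.
  under [RHS]eq_bigr do under eq_bigr do rewrite mulr_sumr.
  under [RHS]eq_bigr do rewrite exchange_big.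
  rewrite [RHS]exchange_big; apply: eq_bigr => z _.
  under [RHS]eq_bigr do rewrite -mulr_sumr; rewrite -mulr_sumr; congr (_ * _).
  rewrite /mulop sum_catbits.
  rewrite -[RHS](sum_diracl (sndbits x) (fun x' => \sum_w \sum_w'
      psi w w' * (U (glue (fstbits x) z) (catbits x' w) *
        (U (glue (fstbits y) z) (catbits (sndbits y) w'))^*))).
  apply: eq_bigr => x' _; rewrite mulr_sumr; apply: eq_bigr => w _.
  rewrite sum_catbits.
  transitivity (\sum_y' (sndbits y == y')%:R * ((sndbits x == x')%:R *
     \sum_w' psi w w' * (U (glue (fstbits x) z) (catbits x' w) *
        (U (glue (fstbits y) z) (catbits y' w'))^*))).
    rewrite mulr_sumr; apply: eq_bigr => y' _; rewrite !mulr_sumr.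
    apply: eq_bigr => w' _; rewrite /tensop /ketbra /adjop !fst_catbits !snd_catbits.
    rewrite -mulnb natrM (eq_sym x') (eq_sym y'); ring.
  by rewrite sum_diracl.
apply: eq_bigr => w _; apply: eq_bigr => w' _; rewrite -bell_sum conjop_liftop.
rewrite mulr_sumr; apply: eq_bigr => X _; rewrite mulr_sumr; apply: eq_bigr => Y _.
by rewrite /g !pr1_jn !pr2_jn; ring.
Qed.

Definition kept (q : 'I_(k + n)) : Q :=
  match split q with inl i => inl i | inr j => inr (lshift a j) end.

Lemma kept_inj : injective kept.
Proof.
move=> q q' e; rewrite -(splitK q) -(splitK q'); move: e; rewrite /kept.
by case: (split q) (split q') => [i|j] [i'|j'] //= [] => [->|/val_inj->].
Qed.

(** The ancilla factors of a product operator contract to a scalar. *)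
Lemma dle_reduce psi l (F : opQ) : dle l F -> dle l (reduce psi F).
Proof.
elim=> {F} [S M Sl MI|A B _ dA _ dB|c A _ dA|A B _ dA AB].
- pose c := \sum_w \sum_w' psi w w' *
    \prod_j M (inr (rshift n j)) (w j) (w' j).
  apply: (@dle_ext _ _ _ (fun x y => c * prodop (fun q => M (kept q)) x y)).
    apply/dle_scale/(@dle_prod _ _ _ [set q | kept q \in S]) => [|q].
      apply: leq_trans Sl; rewrite -(card_imset _ kept_inj).
      by apply/subset_leq_card/subsetP => q /imsetP[q' + ->]; rewrite inE.
    by rewrite inE; apply: MI.
  move=> x y; rewrite mulr_suml; apply: eq_bigr => w _.
  rewrite mulr_suml; apply: eq_bigr => w' _; rewrite -mulrA; congr (_ * _).
  rewrite mulrC /prodop big_split_ord big_sumType big_split_ord /= -mulrA.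
  congr (_ * (_ * _)).
  + by apply: eq_bigr => i _; rewrite !ffunE -!fstbitsE /kept split_lshift !ffunE.
  + by apply: eq_bigr => i _; rewrite !ffunE /kept split_rshift split_lshift !sndbitsE.
  + by apply: eq_bigr => i _; rewrite !ffunE split_rshift.
- apply: dle_ext (dle_add dA dB) _ => x y; rewrite /reduce -big_split /=.
  apply: eq_bigr => w _; rewrite -big_split /=; apply: eq_bigr => w' _.
  by rewrite mulrDr.
- apply: dle_ext (dle_scale c dA) _ => x y; rewrite /reduce mulr_sumr.
  apply: eq_bigr => w _; rewrite mulr_sumr; apply: eq_bigr => w' _.
  by rewrite mulrCA.
- apply: dle_ext dA _ => x y; apply: eq_bigr => w _; apply: eq_bigr => w' _.
  by rewrite AB.
Qed.

(** Spectral theorem: [phi] lists the eigenvectors scaled by the square roots of their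
    eigenvalues. *)
Lemma state_decomposition (psi : op R a) : is_state psi ->
  exists (p : nat) (phi : 'I_p -> bits a -> C),
    (forall w w', psi w w' = \sum_j phi j w * (phi j w')^*) /\
    \sum_j sqn (phi j) = 1.
Proof.
case=> herm [pos tr1].
pose A : 'M[C]_#|{: bits a}| := \matrix_(i, j) psi (enum_val i) (enum_val j).
have hA : A \is hermsymmx.
  apply/is_hermitianmxP; rewrite expr0 scale1r; apply/matrixP => i j.
  by rewrite !mxE -herm.
have /hermitian_normalmx/orthomx_spectralP := hA.
have uP := spectral_unitarymx A; rewrite (invmx_unitary uP).
set P := spectralmx A in uP *; set D := spectral_diag A => AE.
have PAP : P *m A *m map_mx Num.conj P^T = diag_mx D.
  rewrite AE !mulmxA (unitarymxP uP) mul1mx -mulmxA (unitarymxP uP).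
  by rewrite mulmx1.
(* Positivity of the state is tested on the conjugate of row [l] of [P], an eigenvector. *)
have D0 l : 0 <= D 0 l.
  have := congr1 (fun B : 'M_ _ => B l l) PAP; rewrite !mxE eqxx mulr1n => <-.
  have := pos (fun w => (P l (enum_rank w))^*); congr (_ <= _).
  rewrite [RHS](reindex (@enum_rank (bits a))) /=; last first.
    by apply: onW_bij; apply: enum_rank_bij.
  rewrite exchange_big; apply: eq_bigr => w' _; rewrite !mxE mulr_suml.
  rewrite [RHS](reindex (@enum_rank (bits a))) /=; last first.
    by apply: onW_bij; apply: enum_rank_bij.
  by apply: eq_bigr => w _; rewrite !mxE !enum_rankK conjCK.
pose phi l w := sqrtC (D 0 l) * (P l (enum_rank w))^*.
have psiE w w' : psi w w' = \sum_j phi j w * (phi j w')^*.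
  have := congr1 (fun B : 'M_ _ => B (enum_rank w) (enum_rank w')) AE.
  rewrite mxE !enum_rankK => ->; rewrite mxE; apply: eq_bigr => l _.
  rewrite mul_mx_diag !mxE /phi rmorphM /= conjCK.
  rewrite (geC0_conj (_ : 0 <= sqrtC (D 0 l))) ?sqrtC_ge0 //.
  by rewrite -{1}(sqrtCK (D 0 l)); ring.
exists _, phi; split=> //; rewrite -tr1 exchange_big /=.
by apply: eq_bigr => w _; rewrite psiE; apply: eq_bigr => j _; rewrite normCK.
Qed.

Lemma sum_jn_catbits (F : bQ -> C) :
  \sum_X F X = \sum_x \sum_w F (jn (fstbits x) (catbits (sndbits x) w)).
Proof.
rewrite sum_jn sum_catbits; apply: eq_bigr => x1 _.
rewrite sum_catbits; apply: eq_bigr => x2 _; apply: eq_bigr => w _.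
by rewrite fst_catbits snd_catbits.
Qed.

(** The form splits into forms of [F] at the test vectors tensored with the conjugates of [phi j].
    Their squared norms add up to those of [u] and [v] because the state has trace 1. *)
Lemma nle_reduce psi (F : opQ) e : is_state psi -> nle F e -> nle (reduce psi F) e.
Proof.
move=> /state_decomposition[p [phi [psiE phi1]]] nF u v.
pose ext j (t : bits (k + n) -> C) (X : bQ) : C :=
  (phi j (sndbits (pr2 X)))^* * t (catbits (pr1 X) (fstbits (pr2 X))).
have extE j t x w : ext j t (jn (fstbits x) (catbits (sndbits x) w)) =
    (phi j w)^* * t x.
  by rewrite /ext pr1_jn pr2_jn snd_catbits fst_catbits catbits_fst_snd.
have sq j t : sqn (ext j t) = sqn (phi j) * sqn t.
  rewrite /sqn sum_jn_catbits mulr_sumr; apply: eq_bigr => x _.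
  rewrite mulr_suml; apply: eq_bigr => w _.
  by rewrite extE normrM norm_conjC exprMn.
have -> : bil (reduce psi F) u v = \sum_j bil F (ext j u) (ext j v).
  transitivity (\sum_x \sum_y \sum_w \sum_w' \sum_j
     (ext j u (jn (fstbits x) (catbits (sndbits x) w)))^* *
     F (jn (fstbits x) (catbits (sndbits x) w))
       (jn (fstbits y) (catbits (sndbits y) w')) *
     ext j v (jn (fstbits y) (catbits (sndbits y) w'))).
    apply: eq_bigr => x _; apply: eq_bigr => y _.
    rewrite mulr_sumr mulr_suml; apply: eq_bigr => w _.
    rewrite mulr_sumr mulr_suml; apply: eq_bigr => w' _.
    rewrite psiE mulr_suml mulr_sumr mulr_suml; apply: eq_bigr => j _.
    by rewrite !extE rmorphM /= conjCK; ring.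
  transitivity (\sum_x \sum_w \sum_y \sum_w' \sum_j
     (ext j u (jn (fstbits x) (catbits (sndbits x) w)))^* *
     F (jn (fstbits x) (catbits (sndbits x) w))
       (jn (fstbits y) (catbits (sndbits y) w')) *
     ext j v (jn (fstbits y) (catbits (sndbits y) w'))).
    by apply: eq_bigr => x _; rewrite exchange_big.
  rewrite -(sum_jn_catbits (fun X => \sum_y \sum_w' \sum_j (ext j u X)^* *
    F X (jn (fstbits y) (catbits (sndbits y) w')) *
     ext j v (jn (fstbits y) (catbits (sndbits y) w')))) [RHS]exchange_big.
  apply: eq_bigr => X _.
  rewrite -(sum_jn_catbits (fun Y => \sum_j (ext j u X)^* * F X Y * ext j v Y)).
  by rewrite exchange_big.
apply: le_trans (_ : \sum_j e * (sqn (ext j u) + sqn (ext j v)) <= _).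
  apply: le_trans (ler_wpM2l _ (ler_norm_sum _ _ _)) _ => //.
  by rewrite mulr_sumr; apply: ler_sum => j _; apply: nF.
rewrite -mulr_sumr; under eq_bigr do rewrite !sq -mulrDr.
by rewrite -mulr_suml phi1 mul1r.
Qed.

End Reduce.
End ChoiReduction.

(** * Pauli coefficients *)

Section PauliBound.
Variable R : realType.
Local Notation C := R[i].

(** Some nontrivial Pauli factor sits on a qubit where the product operator is the identity, and
    that factor is traceless. *)
Lemma pcoef_dle m (A : op R m) l sigma : dle l A -> (l < pweight sigma)%N ->
  pcoef A sigma = 0.
Proof.
move=> dA lsigma; rewrite /pcoef.
suff -> : \sum_x \sum_y (pauli R sigma x y)^* * A x y = 0 by rewrite mulr0.
elim: dA => {A} [S M Sl MI|A B _ dA _ dB|c A _ dA|A B _ dA AB].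
- transitivity (\prod_q \sum_b \sum_b' (pauli1 R (sigma q) b b')^* * M q b b').
    rewrite -sum_prod_ffun; apply: eq_bigr => x _.
    rewrite -sum_prod_ffun; apply: eq_bigr => y _.
    by rewrite /pauli rmorph_prod -big_split.
  have [q] : exists q, q \in [set q | sigma q != ord0] :\: S.
    apply/set0Pn; rewrite -card_gt0 cardsD subn_gt0.
    apply: leq_ltn_trans lsigma; apply: leq_trans Sl.
    by rewrite subset_leq_card // subsetIr.
  rewrite !inE => /andP[/MI Mq sq]; rewrite (bigD1 q) //= !big_bool !Mq /idb /=.
  rewrite !(mulr1, mulr0, addr0, add0r) /pauli1 /=.
  by case: (sigma q) sq => -[|[|[|[|//]]]] //= _ _;
    rewrite ?rmorphN /= ?conjC0 ?conjC1 ?addr0 ?addNr mul0r.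
- transitivity (\sum_x \sum_y (pauli R sigma x y)^* * A x y +
     \sum_x \sum_y (pauli R sigma x y)^* * B x y); last by rewrite dA dB addr0.
  rewrite -big_split /=; apply: eq_bigr => x _.
  by rewrite -big_split /=; apply: eq_bigr => y _; rewrite mulrDr.
- transitivity (c * \sum_x \sum_y (pauli R sigma x y)^* * A x y); last first.
    by rewrite dA mulr0.
  rewrite mulr_sumr; apply: eq_bigr => x _; rewrite mulr_sumr.
  by apply: eq_bigr => y _; rewrite mulrCA.
- by rewrite -[RHS]dA; apply: eq_bigr => x _; apply: eq_bigr => y _; rewrite AB.
Qed.

Lemma pdeg_dle m (A : op R m) l : dle l A -> (pdeg A <= l)%N.
Proof.
move=> dA; apply/bigmax_leqP => sigma; apply: contraNT; rewrite -ltnNge.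
by move=> /(pcoef_dle dA)->.
Qed.

(** The bilinear bound is taken at u = Av / e, where the AM-GM form is sharp. *)
Lemma opnorm_le_nle m (A : op R m) (e : R) : 0 < e -> nle A e%:C%C -> opnorm_le A e.
Proof.
move=> e0 nA; split=> [|v]; first exact: ltW.
have eC : 0 < e%:C%C by rewrite ltcR.
set w := fun x => \sum_y A x y * v y.
have := nA (fun x => (e%:C%C)^-1 * w x) v.
have -> : bil A (fun x => (e%:C%C)^-1 * w x) v = (e%:C%C)^-1 * sqn w.
  rewrite /sqn mulr_sumr; apply: eq_bigr => x _.
  transitivity (((e%:C%C)^-1 * w x)^* * \sum_y A x y * v y).
    by rewrite [RHS]mulr_sumr; apply: eq_bigr => y _; rewrite mulrA.
  rewrite -/(w x).
  by rewrite rmorphM /= geC0_conj ?invr_ge0 ?ltW // normCK; ring.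
have -> : sqn (fun x => (e%:C%C)^-1 * w x) = (e%:C%C)^-1 ^+ 2 * sqn w.
  rewrite /sqn mulr_sumr; apply: eq_bigr => x _.
  by rewrite normrM exprMn ger0_norm // invr_ge0 ltW.
rewrite ger0_norm ?mulr_ge0 ?sqn_ge0 ?invr_ge0 ?(ltW eC) // mulrDr.
rewrite expr2 -mulrA mulVKf ?gt_eqF // -lerBlDl.
rewrite (_ : _ - _ = (e%:C%C)^-1 * sqn w); last ring.
by rewrite ler_pdivrMl // mulrA -expr2 rmorphXn.
Qed.

End PauliBound.

(** * Choice of parameters *)

Section DegreeBudget.
Variable R : realType.
Implicit Types (k i l r : nat) (N : nat).

(** The square on [K] is stable under the layer recursion b' = (K^4 N^2 b)^(1/3), which keeps the
    power of the logarithm independent of the depth. *)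
Definition degree_bound (K : R) (N k i : nat) : R :=
  K ^+ 2 * (N%:R `^ (1 - (3%:R ^+ i)^-1) * k%:R `^ ((3%:R ^+ i)^-1 / 2)).

Lemma degree_bound_ge1 K N k i : 1 <= K -> (0 < N)%N -> (0 < k)%N ->
  1 <= degree_bound K N k i.
Proof.
move=> K1 N0 k0; rewrite -[leLHS]mulr1 ler_pM ?exprn_ege1 //.
have pow1 (x : R) (j : nat) : (0 < j)%N -> 0 <= x -> 1 <= j%:R `^ x.
  move=> j0 x0; have := ge0_ler_powR x0 (_ : 1 \is Num.nneg) (_ : j%:R \is Num.nneg).
  by rewrite powR1 => -> //; rewrite ?nnegrE // ler1n.
have V1 : 0 <= (3%:R ^+ i : R)^-1 <= 1.
  by rewrite invr_ge0 exprn_ge0 //= invf_le1 ?exprn_ege1 ?exprn_gt0 ?ler1n ?ltr0n.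
case/andP: V1 => V0 V1; rewrite -[leLHS]mulr1 ler_pM // pow1 ?subr_ge0 //.
by rewrite divr_ge0.
Qed.

(** The layer recursion, cubed to avoid cube roots: the exponents satisfy 3e' = 2 + e for [N] and
    3f' = f for [k], and K^6 = K^4 K^2. *)
Lemma degree_bound_cube K N k i : (0 < N)%N -> (0 < k)%N ->
  degree_bound K N k i.+1 ^+ 3 = K ^+ 4 * N%:R ^+ 2 * degree_bound K N k i.
Proof.
move=> N0 k0; have N0' : N%:R != 0 :> R by rewrite pnatr_eq0 -lt0n.
have k0' : k%:R != 0 :> R by rewrite pnatr_eq0 -lt0n.
rewrite /degree_bound !exprMn -!(powR_mulrn _ (powR_ge0 _ _)) -!powRrM.
have -> : (1 - (3%:R ^+ i.+1)^-1) * 3%:R = 2%:R + (1 - (3%:R ^+ i)^-1) :> R.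
  by rewrite exprS; field; rewrite expf_neq0 // pnatr_eq0.
have -> : (3%:R ^+ i.+1)^-1 / 2 * 3%:R = (3%:R ^+ i)^-1 / 2 :> R.
  by rewrite exprS; field; rewrite expf_neq0 // pnatr_eq0.
rewrite powRD ?N0' ?implybT // powR_mulrn //.
by ring.
Qed.

(* Gates are small when they act on at most w^2 qubits; the optimal w is about
   (N / lam)^(1/3) for operators of degree lam. *)
Lemma exists_cutoff N (lam : R) : (0 < N)%N -> 1 <= lam <= N%:R ->
  exists2 w, (0 < w)%N & w%:R ^+ 3 * lam <= N%:R < w.+1%:R ^+ 3 * lam.
Proof.
move=> N0 /andP[lam1 lamN]; have lam0 : 0 < lam by apply: lt_le_trans lam1.
pose P w := w%:R ^+ 3 * lam <= N%:R.
have exP : exists w, P w by exists 1%N; rewrite /P expr1n mul1r.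
have bP w : P w -> (w <= N)%N.
  rewrite /P => h; rewrite -(ler_nat R); apply: le_trans h.
  rewrite -[leLHS]mulr1 ler_pM // -natrX ler_nat.
  by rewrite -{1}(expn1 w); case: w => // w; rewrite leq_pexp2l.
exists (ex_maxn exP bP); case: ex_maxnP => w Pw wmax.
  by apply: wmax; rewrite /P expr1n mul1r.
rewrite [_ <= _]Pw ltNge /=; apply/negP => /wmax; by rewrite ltnn.
Qed.

(** With mu = b' / K, the small gates give l w^2 <= mu and the large ones 2D <= 32 r mu. The sum is
    at most 33 r mu = b', whence the 33 in [K]. *)
Lemma degree_bound_step (N k Qc r i l : nat) :
  let K : R := (33 * r)%:R in
  (0 < N)%N -> (0 < k)%N -> (0 < r)%N -> (Qc <= 2 * N)%N ->
  l%:R <= degree_bound K N k i ->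
  (exists2 w, (0 < w)%N & forall D, (D * w <= 4 * r * Qc)%N ->
     (l * w ^ 2 + 2 * D)%:R <= degree_bound K N k i.+1) \/
  Qc%:R <= degree_bound K N k i.+1.
Proof.
move=> K N0 k0 r0 QN lb; have r1 : 1 <= r%:R :> R by rewrite ler1n.
have KE : K = 33 * r%:R by rewrite /K natrM.
have K1 : 1 <= K by rewrite KE; lra.
have K_ge0 : 0 <= K by lra.
have cube := degree_bound_cube K i N0 k0.
have b1 := degree_bound_ge1 i K1 N0 k0.
have b1' := degree_bound_ge1 i.+1 K1 N0 k0.
set b := degree_bound K N k i in lb cube b1 *.
set b' := degree_bound K N k i.+1 in cube b1' *.
have NR : 1 <= N%:R :> R by rewrite ler1n.
have cmp (x y : R) : 0 <= y -> x ^+ 3 <= y ^+ 3 -> x <= y.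
  move=> y0; case: (leP x 0) => [x0 _|x0]; first exact: le_trans y0.
  by rewrite ler_pXn2r // nnegrE ltW.
(* Above [N] there is no cutoff w >= 1, but then the next budget already exceeds the trivial degree
   2N. *)
have [bN|Nb] := leP b N%:R; last first.
  right; apply: le_trans (_ : K * N%:R <= _).
    apply: le_trans (_ : (2 * N)%:R <= _); first by rewrite ler_nat.
    by rewrite natrM ler_wpM2r //; lra.
  apply: cmp; first by lra.
  rewrite cube (_ : _ ^+ 3 = K ^+ 3 * N%:R ^+ 2 * N%:R); last ring.
  rewrite (_ : _ * b = K ^+ 3 * N%:R ^+ 2 * (K * b)); last ring.
  rewrite ler_wpM2l ?mulr_ge0 ?exprn_ge0 //.
  by rewrite -[leLHS]mul1r ler_pM // ltW.
left; have [|w w0 /andP[wN Nw]] := @exists_cutoff N b N0; first by rewrite b1.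
exists w => // D Dw; pose mu := b' / K.
have K0 : K != 0 by apply/eqP; lra.
have b_ge0 : 0 <= b by lra.
have mu0 : 0 <= mu by rewrite divr_ge0 //; lra.
have b'E : b' = mu * K by rewrite divfK.
have muE : b * N%:R ^+ 2 <= mu ^+ 3.
  rewrite /mu expr_div_n cube; rewrite ler_pdivlMr; last by rewrite exprn_gt0 //; lra.
  rewrite (_ : _ * b = K ^+ 3 * (K * (b * N%:R ^+ 2))); last ring.
  rewrite mulrC ler_wpM2l ?exprn_ge0 //.
  by rewrite -[leLHS]mul1r ler_wpM2r // mulr_ge0 ?exprn_ge0.
have w1 : 1 <= w%:R :> R by rewrite ler1n.
have bw : b * w%:R ^+ 2 <= mu.
  apply: cmp => //; apply: le_trans muE.
  rewrite (_ : _ ^+ 3 = b * (w%:R ^+ 3 * b) ^+ 2); last ring.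
  apply: ler_wpM2l => //; apply: lerXn2r => //; rewrite nnegrE //.
  by rewrite mulr_ge0 ?exprn_ge0.
(* Maximality of the cutoff enters here: N < (w + 1)^3 b <= (2w)^3 b. *)
have Nmu : N%:R <= 2 * mu * w%:R.
  apply: cmp; first by rewrite mulr_ge0 // mulr_ge0.
  rewrite (_ : (2 * mu * w%:R) ^+ 3 = mu ^+ 3 * (2 * w%:R) ^+ 3); last ring.
  apply: le_trans (_ : b * N%:R ^+ 2 * (2 * w%:R) ^+ 3 <= _); last first.
    by rewrite ler_wpM2r ?exprn_ge0 ?mulr_ge0.
  rewrite (_ : _ ^+ 3 = N%:R ^+ 2 * N%:R); last ring.
  rewrite (_ : b * _ * _ = N%:R ^+ 2 * ((2 * w%:R) ^+ 3 * b)); last ring.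
  apply: ler_wpM2l; first exact: exprn_ge0.
  apply: le_trans (ltW Nw) _; apply: ler_wpM2r => //.
  have w2 : w.+1%:R <= 2 * w%:R :> R by rewrite -natr1; lra.
  by apply: lerXn2r; rewrite ?nnegrE //; lra.
have DR : D%:R <= 16 * r%:R * mu.
  rewrite -(ler_pM2r (_ : 0 < w%:R)); last lra.
  apply: le_trans (_ : (4 * r * (2 * N))%:R <= _).
    by rewrite -natrM ler_nat; apply: leq_trans Dw _; rewrite leq_mul2l QN orbT.
  rewrite !natrM; apply: le_trans (_ : 4 * r%:R * (2 * (2 * mu * w%:R)) <= _).
    by rewrite !ler_wpM2l ?mulr_ge0.
  by rewrite le_eqVlt; apply/orP; left; apply/eqP; ring.
rewrite natrD !natrM b'E.
have h1 : l%:R * (w ^ 2)%:R <= mu.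
  by apply: le_trans bw; rewrite natrX ler_wpM2r ?exprn_ge0.
have h2 : mu <= mu * r%:R by rewrite -[leLHS]mulr1 ler_wpM2l.
by rewrite KE; nra.
Qed.

(** From exp(-1/2) >= 1 - 1/2. It converts the binary logarithm inside [r] into [ln]. *)
Lemma ln2_ge_half : 2^-1 <= ln 2%:R :> R.
Proof.
rewrite -[leLHS]expRK ler_ln ?posrE ?expR_gt0 //.
have := expR_ge1Dx (- 2^-1 : R); rewrite expRN => h.
rewrite -[leLHS]invrK -[leRHS]invrK lef_pV2 ?posrE ?invr_gt0 ?expR_gt0 //.
by apply: le_trans h; lra.
Qed.

Lemma up_log2_le N : (0 < N)%N -> (up_log 2 N)%:R <= 1 + 2 * ln N%:R :> R.
Proof.
move=> N0; have lnN : 0 <= ln N%:R :> R by rewrite ln_ge0 // ler1n.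
have [N1|N1] := leqP N 1.
  have -> : up_log 2 N = 0%N by apply/eqP; rewrite up_log_eq0 N1 orbT.
  by rewrite addr_ge0 ?mulr_ge0.
have u0 : (0 < up_log 2 N)%N by rewrite up_log_gt0.
have := up_log_gtn (isT : 1 < 2)%N N1; rewrite -(ltr_nat R).
rewrite -ltr_ln ?posrE ?ltr0n ?expn_gt0 // natrX lnXn ?ltr0n // => /ltW h.
rewrite -{1}(prednK u0) -natr1 [leLHS]addrC lerD2l.
apply: le_trans (ler_wpM2l _ h) => //; rewrite -[ln _ *+ _]mulr_natl mulrCA ler_peMr //.
by have := ln2_ge_half; lra.
Qed.

End DegreeBudget.

(** Since 33 (3 + 2 ln N) <= 99 (1 + ln N), squaring gives 9801 = 99^2 and the exponent 2 of the
    logarithm. *)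
Lemma degree_bound_poly (R : realType) N k d (N0 : (0 < N)%N) :
  degree_bound (33 * (up_log 2 N + 2))%:R N k d <=
  9801%:R * N%:R `^ (1 - (3%:R ^+ d)^-1) * k%:R `^ ((3%:R ^+ d)^-1 / 2) *
    (1 + ln N%:R) ^+ 2 :> R.
Proof.
set p := _ `^ _; set q := _ `^ _; rewrite /degree_bound -/p -/q.
have L0 : 0 <= ln N%:R :> R by rewrite ln_ge0 // ler1n.
have K1 : (33 * (up_log 2 N + 2))%:R <= 99 * (1 + ln N%:R) :> R.
  by rewrite natrM natrD; have := up_log2_le R N0; lra.
rewrite (_ : _ * _ * _ * _ = (99 * (1 + ln N%:R)) ^+ 2 * (p * q)); last ring.
rewrite ler_wpM2r ?mulr_ge0 ?powR_ge0 // lerXn2r ?nnegrE //; lra.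
Qed.

(** The choice of [r] gives 4^r >= 16 N^2, which dominates 4 Qc n <= 8 N^2. *)
Lemma eta_bound (R : realType) (n N Qc : nat) :
  (0 < n)%N -> (n <= N)%N -> (Qc <= 2 * N)%N ->
  let r := (up_log 2 N + 2)%N in
  4 * Qc%:R * (4 ^ r)%:R^-1 <= n%:R^-1 :> R[i] /\ (4 ^ r)%:R^-1 <= n%:R^-1 :> R[i].
Proof.
move=> n0 nN QN r; have N0 : (0 < N)%N by apply: leq_trans nN.
have h4 : (16 * (N * N) <= 4 ^ r)%N.
  rewrite /r expnD mulnC leq_mul2r /= (_ : 4 = 2 ^ 2)%N // -expnM mulnC expnM.
  by rewrite -(expnMn N N 1) ?expn1 // leq_sqr up_logP.
have r0 : 0 < (4 ^ r)%:R :> R[i] by rewrite ltr0n expn_gt0.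
split; last by rewrite lef_pV2 ?posrE // ?ltr0n // ler_nat; nia.
rewrite ler_pdivrMr // [leRHS]mulrC ler_pdivlMr ?ltr0n // -!natrM ler_nat; nia.
Qed.

(* Absolute constants C0 (for O / O~) and c0 (exponent of the polylog factor):
   for every n >= 1, a, depth d >= 1, k <= n, every depth-d QAC0 circuit U on
   n + a qubits and every ancilla state psi,
     deg_eps(2^{-k} Phi_{U,psi}) <= l  with  eps = C0 d / n  and
     l = C0 (n+a)^{1 - 3^{-d}} k^{3^{-d}/2} (1 + ln (n+a))^c0. *)
Theorem theorem7p2 (R : realType) :
  exists (C0 c0 : nat), (0 < C0)%N /\
  forall (n a d k : nat) (U : op R (n + a)) (psi : op R a),
    (1 <= n)%N -> (1 <= d)%N -> (k <= n)%N ->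
    QAC0 d U -> is_state psi ->
    degeps_le
      (scaleop ((2%:R ^+ k)^-1) (choi (@chan R n a k U psi)))
      (C0%:R * d%:R / n%:R)
      (C0%:R * ((n + a)%:R `^ (1 - (3%:R ^+ d)^-1))
             * (k%:R `^ ((3%:R ^+ d)^-1 / 2))
             * (1 + ln (n + a)%:R) ^+ c0).
Proof.
exists 9801%N, 2%N; split=> // n a d k U psi n1 d1 kn [Ls [Ms [uL [vM ->]]]] psist.
have km : (k <= n + a)%N by apply: leq_trans kn (leq_addr _ _).
have N0 : (0 < n + a)%N by rewrite addn_gt0 n1.
have cardQ : #|{: 'I_k + 'I_(n + a)}| = (k + (n + a))%N by rewrite card_sum !card_ord.
have Q0 : (0 < #|{: 'I_k + 'I_(n + a)}|)%N by rewrite cardQ addn_gt0 N0 orbT.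
have eps0 : 0 < 9801%:R * d%:R / n%:R :> R by rewrite divr_gt0 ?mulr_gt0 ?ltr0n.
have L0 : 0 <= ln (n + a)%:R :> R by rewrite ln_ge0 // ler1n.
(* For k = 0 the power of [k] is 0, so degree exactly 0 is required. The Bell projector is then the
   identity, and the circuit keeps its degree. *)
have [k0|k0] := posnP k.
  subst k; set A := scaleop _ _; exists A; split; last first.
    apply: (opnorm_le_nle eps0) => u v; rewrite /bil big1 => [|x _]; last first.
      by rewrite big1 // => y _; rewrite /subop subrr mulr0 mul0r.
    by rewrite normr0 mulr0 mulr_ge0 ?addr_ge0 ?sqn_ge0 // ler0c ltW.
  apply: le_trans (_ : 0 <= _); last first.
    by rewrite !mulr_ge0 ?powR_ge0 ?exprn_ge0 // addr_ge0.
  rewrite (_ : 0 = 0%:R) // ler_nat; apply: pdeg_dle.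
  apply: dle_ext (fun x y => esym (choi_chanE km _ psi x y)).
  apply: dle_reduce; apply: circ_exact => //.
  apply: (@dle_ext _ _ _ (prodop (fun=> @idb _))).
    by apply: (@dle_prod _ _ _ set0); rewrite ?cards0.
  move=> x y; rewrite bellE /prodop big_sumType /=; congr (_ * _).
  by rewrite !big_ord0.
set r := (up_log 2 (n + a) + 2)%N; set K : R := (33 * r)%:R.
have r0 : (0 < r)%N by rewrite /r addn2.
have QN : (#|{: 'I_k + 'I_(n + a)}| <= 2 * (n + a))%N.
  by rewrite cardQ mul2n -addnn leq_add2r.
pose good i l := l%:R <= degree_bound K (n + a) k i.
have [eta1 eta2] := eta_bound R n1 (leq_addr a n) QN.
have [nB [w [B [wk dB nAB]]]] := bell_approx (R[i]) km r k0.
(* From w^2 <= 8k <= 9k comes w <= 3 sqrt(k), so 4 w r <= 12 r^2 sqrt(k), well below K^2 sqrt(k). *)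
have good0 : good 0 (4 * w * r)%N.
  rewrite /good /degree_bound expr0 invr1 subrr powRr0 !mul1r powR12_sqrt //.
  have w3 : w%:R <= 3 * Num.sqrt k%:R :> R.
    rewrite -(ler_pXn2r (_ : 0 < 2)%N) ?nnegrE ?mulr_ge0 ?sqrtr_ge0 //.
    rewrite exprMn sqr_sqrtr // -!natrX -natrM ler_nat; apply: leq_trans wk _.
    by rewrite leq_mul2r orbT.
  have rr : r%:R <= r%:R ^+ 2 :> R by rewrite -natrX ler_nat; nia.
  rewrite /K !natrM exprMn.
  apply: le_trans (_ : 4 * (3 * Num.sqrt k%:R) * r%:R ^+ 2 <= _).
    by rewrite ler_pM ?ler_wpM2l ?mulr_ge0.
  rewrite (_ : _ * _ = 12 * (r%:R ^+ 2 * Num.sqrt k%:R)); last ring.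
  rewrite -[leRHS]mulrA ler_wpM2r ?mulr_ge0 ?exprn_ge0 ?sqrtr_ge0 //.
  by rewrite -natrX ler_nat.
have e0 : 0 <= (4 ^ r)%:R^-1 :> R[i] by rewrite invr_ge0.
have step i l : good i l -> _ := degree_bound_step N0 k0 r0 QN.
have [l' [B' [gl' dB' nB']]] :=
  circ_approx Q0 step uL vM e0 nB nAB dB good0.
exists (reduce psi B'); split.
  apply: le_trans (degree_bound_poly R k d N0); apply: le_trans gl'.
  by rewrite ler_nat; apply/pdeg_dle/dle_reduce.
apply: (opnorm_le_nle eps0).
apply: nle_ext (nle_le _ (nle_reduce psist nB')) => [x y|].
  rewrite /subop (choi_chanE km) /reduce -sumrB; apply: eq_bigr => z _.
  by rewrite -sumrB; apply: eq_bigr => z' _; rewrite mulrBr.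
(* Each layer costs at most 1/n. The initial error 1/n is absorbed into d/n, as d >= 1. *)
apply: le_trans (_ : d%:R * n%:R^-1 + d%:R * n%:R^-1 <= _).
  apply: lerD; first by rewrite ler_wpM2l.
  by apply: le_trans eta2 _; rewrite ler_peMl ?invr_ge0 // ler1n.
have -> : (9801%:R * d%:R / n%:R)%:C%C = 9801%:R * (d%:R * n%:R^-1) :> R[i].
  by rewrite !rmorphM fmorphV !rmorph_nat mulrA.
have t0 : 0 <= d%:R * n%:R^-1 :> R[i] by rewrite mulr_ge0 ?invr_ge0.
rewrite -mulr2n -[leLHS]mulr_natl; apply: (ler_wpM2r t0).
by rewrite ler_nat.
Qed.
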